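(* Let $\mathbb{K}$ be a field of characteristic zero. For any integer $n \geq 3$, every $3$-triangular automorphism in $\mathrm{GA}_n(\mathbb{K})$ is either affine or co-tame.
   Context: $\mathrm{GA}_n(\mathbb{K})$ is the group of polynomial automorphisms of $\mathbb{A}^n_{\mathbb{K}}$. An element $\phi$ is written $\phi=(H_1,\ldots,H_n)$ with $H_i=(x_i)\phi\in\mathbb{K}[x_1,\ldots,x_n]$; for a polynomial $P$ one writes $(P)\phi=P(H_1,\ldots,H_n)$, and composition satisfies $(P)(\phi\psi)=((P)\phi)\psi$. $\mathrm{Aff}_n(\mathbb{K})$ is the affine subgroup (automorphisms all of whose components have degree one). $\mathrm{BA}_n(\mathbb{K})$ is the subgroup of triangular automorphisms $(u_1x_1+P_1,u_2x_2+P_2(x_1),\ldots,u_nx_n+P_n(x_1,\ldots,x_{n-1}))$ with $u_i\in\mathbb{K}^*$ and $P_i\in\mathbb{K}[x_1,\ldots,x_{i-1}]$. $\mathrm{TA}_n(\mathbb{K})=\langle \mathrm{Aff}_n(\mathbb{K}),\mathrm{BA}_n(\mathbb{K})\rangle$ is the tame subgroup. An automorphism $\phi\in\mathrm{GA}_n(\mathbb{K})$ is co-tame if $\mathrm{TA}_n(\mathbb{K})\subset\langle \phi,\mathrm{Aff}_n(\mathbb{K})\rangle$. An automorphism is $m$-triangular if it can be written as $\alpha_0\tau_1\alpha_1\cdots\tau_m\alpha_m$ with each $\tau_i\in\mathrm{BA}_n(\mathbb{K})$ and each $\alpha_i\in\mathrm{Aff}_n(\mathbb{K})$. *)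

(* Defs.v *)
From HB Require Import structures.
From mathcomp Require Import all_boot all_order all_algebra.
From mathcomp Require Export mpoly.

Set Implicit Arguments.
Unset Strict Implicit.
Unset Printing Implicit Defensive.

Import GRing.Theory.
Local Open Scope ring_scope.

Section Endomorphisms.
Context {K : fieldType} {n : nat}.
Implicit Types (p : {mpoly K[n]}) (f g h : n.-tuple {mpoly K[n]}).

(* Automorphisms act on polynomials on the right, so the i-th component of
   f g is ((x_i) f) g: substitute the components of g into that of f. *)
Definition endo_mul f g : n.-tuple {mpoly K[n]} :=
  [tuple tnth f i \mPo g | i < n].

Definition endo_one : n.-tuple {mpoly K[n]} := [tuple 'X_i | i < n].

Lemma comp_endo_mul p f g : p \mPo endo_mul f g = (p \mPo f) \mPo g.
Proof.
rewrite !(comp_mpolyE p) linear_sum /=; apply: eq_bigr => m _.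
rewrite linearZ /= rmorph_prod /=; congr (_ *: _).
by apply: eq_bigr => i _; rewrite rmorphXn /= tnth_mktuple.
Qed.

Lemma endo_mulA : associative endo_mul.
Proof.
by move=> f g h; apply: eq_from_tnth => i; rewrite !tnth_mktuple comp_endo_mul.
Qed.

Lemma endo_mul1 : right_id endo_one endo_mul.
Proof.
by move=> f; apply: eq_from_tnth => i; rewrite !tnth_mktuple comp_mpoly_id.
Qed.

Lemma endo_1mul : left_id endo_one endo_mul.
Proof.
move=> f; apply: eq_from_tnth => i.
by rewrite !tnth_mktuple comp_mpolyXU -tnth_nth.
Qed.

End Endomorphisms.

(* A polynomial automorphism of affine n-space, stored with its (unique)
   inverse so that inversion is computable. *)
Record GA (K : fieldType) (n : nat) := MkGA {
  ga_pair : n.-tuple {mpoly K[n]} * n.-tuple {mpoly K[n]};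
  ga_pairP : (endo_mul ga_pair.1 ga_pair.2 == endo_one)
          && (endo_mul ga_pair.2 ga_pair.1 == endo_one)
}.

HB.instance Definition _ K n := [isSub for @ga_pair K n].
HB.instance Definition _ K n := [Choice of GA K n by <:].

Definition comps K n (phi : GA K n) : n.-tuple {mpoly K[n]} :=
  (ga_pair phi).1.

Definition component K n (phi : GA K n) (i : 'I_n) : {mpoly K[n]} :=
  tnth (comps phi) i.
Coercion component : GA >-> Funclass.

Section Group.
Context {K : fieldType} {n : nat}.
Implicit Types phi psi : GA K n.

Lemma comps_inj : injective (@comps K n).
Proof.
move=> [[f f'] fP] [[g g'] gP]; rewrite /comps /= => efg.
apply: val_inj => /=; subst g; congr (_, _).
move: fP gP => /= /andP[_ /eqP f'f] /andP[/eqP fg' _].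
by rewrite -[LHS]endo_mul1 -fg' endo_mulA f'f endo_1mul.
Qed.

Fact ga_one_subproof :
  (endo_mul (@endo_one K n) endo_one == endo_one)
  && (endo_mul (@endo_one K n) endo_one == endo_one).
Proof. by rewrite endo_mul1 eqxx. Qed.

Definition ga_one : GA K n := @MkGA K n (endo_one, endo_one) ga_one_subproof.

Fact ga_mul_subproof phi psi :
  let f := endo_mul (ga_pair phi).1 (ga_pair psi).1 in
  let f' := endo_mul (ga_pair psi).2 (ga_pair phi).2 in
  (endo_mul f f' == endo_one) && (endo_mul f' f == endo_one).
Proof.
move: phi psi => [[f f'] fP] [[g g'] gP] /=.
move: fP gP => /= /andP[/eqP ff' /eqP f'f] /andP[/eqP gg' /eqP g'g].
rewrite !endo_mulA -(endo_mulA f) gg' endo_mul1 ff'.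
by rewrite -(endo_mulA g') f'f endo_mul1 g'g !eqxx.
Qed.

Definition ga_mul phi psi : GA K n := @MkGA K n (_, _) (ga_mul_subproof phi psi).

Fact ga_inv_subproof phi :
  (endo_mul (ga_pair phi).2 (ga_pair phi).1 == endo_one)
  && (endo_mul (ga_pair phi).1 (ga_pair phi).2 == endo_one).
Proof. by rewrite andbC ga_pairP. Qed.

Definition ga_inv phi : GA K n := @MkGA K n (_, _) (ga_inv_subproof phi).

Fact ga_mulA : associative ga_mul.
Proof. by move=> f g h; apply: comps_inj; apply: endo_mulA. Qed.

Fact ga_1mul : left_id ga_one ga_mul.
Proof. by move=> f; apply: comps_inj; apply: endo_1mul. Qed.

Fact ga_mul1 : right_id ga_one ga_mul.
Proof. by move=> f; apply: comps_inj; apply: endo_mul1. Qed.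

Fact ga_Vmul : left_inverse ga_one ga_inv ga_mul.
Proof.
by move=> f; apply: comps_inj; case/andP: (ga_pairP f) => _ /eqP.
Qed.

Fact ga_mulV : right_inverse ga_one ga_inv ga_mul.
Proof.
by move=> f; apply: comps_inj; case/andP: (ga_pairP f) => /eqP.
Qed.

HB.instance Definition _ := isGroup.Build (GA K n)
  ga_mulA ga_1mul ga_mul1 ga_Vmul ga_mulV.

Lemma ga_mulE phi psi (i : 'I_n) :
  (phi * psi)%g i = phi i \mPo comps psi.
Proof. by rewrite /component /comps /= tnth_mktuple. Qed.

Lemma ga_oneE (i : 'I_n) : (1%g : GA K n) i = 'X_i.
Proof. by rewrite /component /comps /= tnth_mktuple. Qed.

End Group.

(* The subgroup generated by a subset of a possibly infinite group. *)
Inductive generated (G : groupType) (S : G -> Prop) : G -> Prop :=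
| gen_incl x : S x -> generated S x
| gen_one : generated S 1%g
| gen_mul x y : generated S x -> generated S y -> generated S (x * y)%g
| gen_inv x : generated S x -> generated S x^-1%g.

Section Subgroups.
Context {K : fieldType} {n : nat}.
Implicit Types phi psi : GA K n.

(* [msize p] is one more than the total degree of a nonzero [p]. *)
Definition affine phi : Prop := forall i, msize (phi i) = 2%N.

(* [p] involves only the variables of index less than [i]. *)
Definition in_first_vars (i : nat) (p : {mpoly K[n]}) : Prop :=
  forall (m : 'X_{1..n}) (j : 'I_n), m \in msupp p -> (i <= j)%N -> m j = 0%N.

Definition triangular phi : Prop :=
  exists (u : 'I_n -> K) (P : 'I_n -> {mpoly K[n]}),
    [/\ forall i, u i != 0,
        forall i : 'I_n, in_first_vars i (P i)
      & forall i, phi i = u i *: 'X_i + P i].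

Definition tame : GA K n -> Prop :=
  generated (fun psi => affine psi \/ triangular psi).

Definition cotame phi : Prop :=
  forall psi, tame psi -> generated (fun chi => chi = phi \/ affine chi) psi.

(* alpha_0 tau_1 alpha_1 ... tau_m alpha_m; here [tau i] is tau_(i+1). *)
Definition m_triangular (m : nat) phi : Prop :=
  exists (alpha : 'I_m.+1 -> GA K n) (tau : 'I_m -> GA K n),
    [/\ forall i, affine (alpha i),
        forall i, triangular (tau i)
      & phi = (alpha ord0 *
               \prod_(i < m) (tau i * alpha (lift ord0 i)))%g].

End Subgroups.

(* Main.v *)
(* Call an automorphism good if it is affine or co-tame. If phi conjugates a
   nonzero translation into a translation, then after affine changes phi
   commutes with a translation in the direction x_k, and conjugating linear
   shears by phi produces elementary maps x_k + P which, by Derksen's argument,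
   generate the tame group together with the affine one unless phi is affine.

   More generally phi is good as soon as a := phi t phi^-1 is affine for some
   nonzero translation t. Indeed, an affine map epsilon commuting with a yields
   phi^-1 epsilon phi commuting with t, which is therefore good. If the linear
   part of a - 1 has corank at least 2, such epsilon of the form x + s u and
   x + s l(x) u, with l a linear form, force phi^-1 t_u phi to be a translation.
   Otherwise the span of 1 and the components of phi is a single Jordan block
   for the derivation d/dx_k, with a basis f_0 = 1, f_1, ..., f_n such that
   f_(i-1) is the derivative of f_i. Conjugating the torus f_i -> s^i f_i by phi
   yields maps normalising the translations along x_k, hence affine ones, and
   the weight decomposition shows that phi is triangular up to affine maps.

   Consequently phi is good whenever phi t phi^-1 is good. If phi is
   3-triangular, then phi t phi^-1 is, for t the translation along the last
   variable, a conjugate h sigma h^-1 of a unipotent triangular sigma, where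
   h t' h^-1 = t for some translation t'. Iterated commutators of sigma with t'
   become trivial. *)
From HB Require Import structures.
Require Import Defs.
From mathcomp Require Import all_boot all_order perm all_algebra.

Set Implicit Arguments.
Unset Strict Implicit.
Unset Printing Implicit Defensive.

Import GRing.Theory.
Local Open Scope ring_scope.

(** * Polynomials in one parameter *)

Section CoefExtraction.
Context {K : fieldType} (charK : [pchar K]%R =i pred0).

Lemma natr_eq0 (m : nat) : (m%:R == 0 :> K) = (m == 0)%N.
Proof. by move/pcharf0P: charK => ->. Qed.

Lemma natrS_neq0 (m : nat) : m.+1%:R != 0 :> K.
Proof. by rewrite natr_eq0. Qed.

Lemma natr_inj (a b : nat) : a%:R = b%:R :> K -> a = b.
Proof.
move=> eab; apply/eqP; rewrite eqn_leq.
have sub0 c d : (c%:R = d%:R :> K) -> (c <= d)%N.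
  move=> ecd; rewrite leqNgt; apply/negP => ltdc.
  have := natr_eq0 (c - d); rewrite natrB ?(ltnW ltdc) // ecd subrr eqxx.
  by move/esym; rewrite subn_eq0 leqNgt ltdc.
by rewrite !sub0.
Qed.

Definition subspace (V : lmodType K) (S : V -> Prop) :=
  S 0 /\ forall (c : K) p q, S p -> S q -> S (c *: p + q).

Lemma subspaceZ (V : lmodType K) (S : V -> Prop) c p :
  subspace S -> S p -> S (c *: p).
Proof. by case=> S0 SD Sp; rewrite -[_ *: _]addr0; apply: SD. Qed.

Lemma subspaceD (V : lmodType K) (S : V -> Prop) p q :
  subspace S -> S p -> S q -> S (p + q).
Proof. by case=> _ SD Sp Sq; rewrite -[p]scale1r; apply: SD. Qed.

Lemma subspaceB (V : lmodType K) (S : V -> Prop) p q :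
  subspace S -> S p -> S q -> S (p - q).
Proof. by case=> _ SD Sp Sq; rewrite addrC -scaleN1r; apply: SD. Qed.

Lemma subspace_sum (V : lmodType K) (S : V -> Prop) (I : Type) (r : seq I)
    (P : pred I) (F : I -> V) :
  subspace S -> (forall i, P i -> S (F i)) -> S (\sum_(i <- r | P i) F i).
Proof.
move=> SS SF; apply: (big_ind S) => //; first by case: SS.
by move=> x y; apply: subspaceD.
Qed.

(* The combination [p(2s) - 2^d p(s)] kills the coefficient of [s^d]. *)
Lemma coef_subspace (V : lmodType K) (S : V -> Prop) (d : nat) (f : nat -> V) :
  subspace S ->
  (forall r : nat, S (\sum_(i < d) r.+1%:R ^+ i *: f i)) ->
  forall i, (i < d)%N -> S (f i).
Proof.
move=> SS; elim: d f => [//|d IHd] f Sf.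
have Slow i : (i < d)%N -> S (f i).
  move=> ltid.
  have c0 : 2%:R ^+ i - 2%:R ^+ d != 0 :> K.
    rewrite subr_eq0 -!natrX; apply/eqP => /natr_inj/eqP.
    by rewrite eqn_exp2l // ltn_eqF.
  rewrite -[f i](scalerK c0); apply: subspaceZ => //.
  apply: (IHd (fun i => (2%:R ^+ i - 2%:R ^+ d) *: f i)) => // r.
  have -> : \sum_(i0 < d) r.+1%:R ^+ i0 *: ((2%:R ^+ i0 - 2%:R ^+ d) *: f i0)
     = (- 2%:R ^+ d) *: (\sum_(i0 < d.+1) r.+1%:R ^+ i0 *: f i0)
       + \sum_(i0 < d.+1) (r.*2.+1).+1%:R ^+ i0 *: f i0.
    rewrite scaler_sumr -big_split big_ord_recr /=.
    have e2 : (r.*2.+1).+1%:R = 2%:R * r.+1%:R :> K.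
      by rewrite -natrM mul2n doubleS.
    rewrite e2 !exprMn !scalerA mulNr scaleNr addNr addr0.
    apply: eq_bigr => j _; rewrite !scalerA exprMn -scalerDl; congr (_ *: _).
    by rewrite mulrBr addrC mulNr ![_ * r.+1%:R ^+ j]mulrC.
  by case: SS => _; apply; apply: Sf.
move=> i; rewrite ltnS leq_eqVlt => /predU1P[->|]; last exact: Slow.
have := Sf 0; rewrite big_ord_recr /= expr1n scale1r => Sd.
rewrite -[f d](addKr (\sum_(i0 < d) 1%:R ^+ i0 *: f i0)) addrC.
apply: subspaceB => //; apply: subspace_sum => // j _.
by apply: subspaceZ => //; apply: Slow.
Qed.

End CoefExtraction.

(** * Polynomials of degree at most one, and the variables that occur in a polynomial *)

Section Polys.
Context {K : fieldType} {n : nat}.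
Implicit Types (p q : {mpoly K[n]}) (t : n.-tuple {mpoly K[n]}).

Lemma comp_mpolyXi i t : 'X_i \mPo t = tnth t i.
Proof. by rewrite comp_mpolyXU -tnth_nth. Qed.

Lemma mpoly_lin p : (msize p <= 2)%N ->
  p = \sum_j p@_U_(j) *: 'X_j + (p@_0%MM)%:MP.
Proof.
move=> sp; apply/mpolyP => m; rewrite mcoeffD mcoeffC raddf_sum /=.
under eq_bigr do rewrite mcoeffZ mcoeffX.
case: (ltnP 1 (mdeg m)) => dm.
  rewrite memN_msupp_eq0 ?msize_mdeg_ge ?(leq_trans sp) //.
  rewrite big1 ?add0r => [|j _].
    by case: eqP dm => [->|_ _]; rewrite ?mdeg0 ?mulr0.
  by case: eqP dm => [<-|_ _]; rewrite ?mdeg1 ?mulr0.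
case: (posnP (mdeg m)) => dm0.
  move/eqP: dm0; rewrite mdeg_eq0 => /eqP ->.
  by rewrite eqxx mulr1 big1 ?add0r // => j _; rewrite mnm1_eq0 mulr0.
have /eqP/mdeg1P[i /eqP ->] : mdeg m = 1%N by apply/eqP; rewrite eqn_leq dm.
rewrite mnm1_eq0 mulr0 addr0 (bigD1 i) //= eqxx mulr1 big1 ?addr0 // => j ji.
by rewrite -mcoeffX mcoeffXU (negPf ji) mulr0.
Qed.

Lemma msize_lin (c : 'I_n -> K) (b : K) :
  (msize (\sum_j c j *: 'X_j + b%:MP : {mpoly K[n]}) <= 2)%N.
Proof.
apply: (leq_trans (msizeD_le _ _)); rewrite geq_max; apply/andP; split;
  last first.
  by rewrite msizeC; case: eqP.
apply: (leq_trans (msize_sum _ _ _)); apply/bigmax_leqP => j _.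
by apply: (leq_trans (msizeZ_le _ _)); rewrite msizeX mdeg1.
Qed.

Lemma mcoeffU_lin (c : 'I_n -> K) (b : K) i :
  (\sum_j c j *: 'X_j + b%:MP : {mpoly K[n]})@_U_(i) = c i.
Proof.
rewrite mcoeffD mcoeffC mnm1_eq0 mulr0 addr0 raddf_sum /= (bigD1 i) //=.
rewrite mcoeffZ mcoeffXU eqxx mulr1 big1 ?addr0 // => j ji.
by rewrite mcoeffZ mcoeffXU (negPf ji) mulr0.
Qed.

Lemma msize2_subspace : subspace (fun p => (msize p <= 2)%N).
Proof.
split=> [|c p q sp sq]; first by rewrite msize0.
apply: (leq_trans (msizeD_le _ _)); rewrite geq_max sq andbT.
exact: leq_trans (msizeZ_le _ _) sp.
Qed.

Lemma comp_lin (c : 'I_n -> K) (b : K) t :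
  (\sum_j c j *: 'X_j + b%:MP) \mPo t = \sum_j c j *: tnth t j + b%:MP.
Proof.
rewrite comp_mpolyD comp_mpolyC raddf_sum /=; congr (_ + _).
by apply: eq_bigr => j _; rewrite comp_mpolyZ comp_mpolyXi.
Qed.

Lemma msize2_comp p t : (msize p <= 2)%N ->
  (forall j, (msize (tnth t j) <= 2)%N) -> (msize (p \mPo t) <= 2)%N.
Proof.
move=> /mpoly_lin -> st; rewrite comp_lin.
apply: (subspaceD msize2_subspace); last by rewrite msizeC; case: eqP.
apply: (subspace_sum _ msize2_subspace) => j _.
exact: (subspaceZ _ msize2_subspace).
Qed.

Lemma mpoly_const p : (msize p <= 1)%N -> p = (p@_0%MM)%:MP.
Proof. exact: msize1_polyC. Qed.

Definition vars (A : pred 'I_n) p :=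
  forall (m : 'X_{1..n}) j, m \in msupp p -> ~~ A j -> m j = 0%N.

Lemma varsC A c : vars A c%:MP.
Proof.
move=> m j; rewrite msuppC; case: eqP => // _; rewrite inE => /eqP -> _.
by rewrite mnm0E.
Qed.

Lemma varsX (A : pred 'I_n) i : A i -> vars A 'X_i.
Proof.
move=> Ai m j; rewrite msuppX inE => /eqP -> Aj; rewrite mnm1E.
by case: eqP Aj => // <-; rewrite Ai.
Qed.

Lemma varsD A p q : vars A p -> vars A q -> vars A (p + q).
Proof.
move=> vp vq m j /msuppD_le; rewrite mem_cat => /orP[mp|mq].
- exact: vp. - exact: vq.
Qed.

Lemma varsM A p q : vars A p -> vars A q -> vars A (p * q).
Proof.
move=> vp vq m j /msuppM_le /allpairsP[[m1 m2] /= [m1p m2q ->]] Aj.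
by rewrite mnmDE (vp _ _ m1p Aj) (vq _ _ m2q Aj).
Qed.

Lemma varsZ A c p : vars A p -> vars A (c *: p).
Proof. by rewrite -mul_mpolyC; apply: varsM; apply: varsC. Qed.

Lemma varsN A p : vars A p -> vars A (- p).
Proof. by rewrite -scaleN1r; apply: varsZ. Qed.

Lemma varsXn A p k : vars A p -> vars A (p ^+ k).
Proof.
move=> vp; elim: k => [|k IH]; first exact: (varsC (c := 1)).
by rewrite exprS; apply: varsM.
Qed.

Lemma vars0 A : vars A 0.
Proof. by rewrite -mpolyC0; apply: varsC. Qed.

Lemma vars_sum A (I : Type) (r : seq I) (P : pred I) (F : I -> {mpoly K[n]}) :
  (forall i, P i -> vars A (F i)) -> vars A (\sum_(i <- r | P i) F i).
Proof.
move=> vF; apply: (big_ind (vars A)) => //; first exact: vars0.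
by move=> x y; apply: varsD.
Qed.

Lemma vars_prod A (I : Type) (r : seq I) (P : pred I) (F : I -> {mpoly K[n]}) :
  (forall i, P i -> vars A (F i)) -> vars A (\prod_(i <- r | P i) F i).
Proof.
move=> vF; apply: (big_ind (vars A)) => //; first exact: (varsC (c := 1)).
by move=> x y; apply: varsM.
Qed.

Lemma sub_vars (A B : pred 'I_n) p :
  (forall i, A i -> B i) -> vars A p -> vars B p.
Proof.
move=> AB vp m j mp Bj; apply: vp mp _; apply: contra Bj; exact: AB.
Qed.

Lemma vars_comp (A B : pred 'I_n) p t : vars A p ->
  (forall j, A j -> vars B (tnth t j)) -> vars B (p \mPo t).
Proof.
move=> vp vt; rewrite comp_mpolyEX big_seq_cond.
apply: vars_sum => m /andP[mp _]; apply: varsZ; rewrite comp_mpolyX.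
apply: vars_prod => i _; case Ai: (A i); first by apply: varsXn; apply: vt.
by rewrite (vp m i mp) ?Ai // expr0; apply: (varsC (c := 1)).
Qed.

Lemma eq_comp_vars (A : pred 'I_n) p t t' : vars A p ->
  (forall j, A j -> tnth t j = tnth t' j) -> p \mPo t = p \mPo t'.
Proof.
move=> vp tt'; rewrite (comp_mpolyEX p t) (comp_mpolyEX p t').
apply: eq_big_seq => m mp; rewrite !comp_mpolyX; congr (_ *: _).
apply: eq_bigr => i _; case Ai: (A i); first by rewrite tt'.
by rewrite (vp m i mp) ?Ai // !expr0.
Qed.

Lemma comp_vars_id (A : pred 'I_n) p t : vars A p ->
  (forall j, A j -> tnth t j = 'X_j) -> p \mPo t = p.
Proof.
move=> vp tX; rewrite -[RHS]comp_mpoly_id; apply: eq_comp_vars vp _ => j Aj.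
by rewrite tX // tnth_mktuple.
Qed.

End Polys.

(** * Taylor expansion along a direction *)

Section Taylor.
Context {K : fieldType} {n : nat}.
Implicit Types (p q : {mpoly K[n]}) (u : 'I_n -> K).

(** The amount [y] is a polynomial and not a scalar, so that translations, linear shears and
    transvections are all instances. *)
Definition shift_along u (y : {mpoly K[n]}) : n.-tuple {mpoly K[n]} :=
  [tuple 'X_i + u i *: y | i < n].

(** Stated as a sigma type so that [sval] names the coefficients of the expansion in [y]. *)
Lemma taylor_along u p :
  {Z : {poly {mpoly K[n]}} | forall y, p \mPo shift_along u y = Z.[y]}.
Proof.
exists (\sum_(m <- msupp p) (p@_m)%:MP%:P *
          \prod_i (('X_i)%:P + (u i)%:MP%:P * 'X) ^+ m i) => y.
rewrite comp_mpolyEX horner_sum; apply: eq_bigr => m _.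
rewrite hornerM hornerC horner_prod mul_mpolyC comp_mpolyX; congr (_ *: _).
apply: eq_bigr => i _; rewrite tnth_mktuple horner_exp !hornerE.
by rewrite mul_mpolyC.
Qed.

Hypothesis charK : [pchar K]%R =i pred0.

(** The binomial theorem for the factor in ['X_j]: the binomial coefficient is the falling factorial
    in the [l]-th derivative divided by [l!], and the terms with [l > m j] vanish. *)
Lemma comp_shiftXm j y (m : 'X_{1..n}) D : (m j < D)%N ->
  'X_[m] \mPo shift_along (fun i => (i == j)%:R) y =
  \sum_(l < D) (l`!%:R^-1 *: 'X_[m]^`M(j, l)) * y ^+ l.
Proof.
move=> mD; rewrite comp_mpolyX (bigD1 j) //= tnth_mktuple eqxx scale1r.
rewrite exprDn.
have -> : \prod_(i < n | i != j)
     tnth (shift_along (fun i0 => (i0 == j)%:R) y) i ^+ m i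
   = \prod_(i < n | i != j) 'X_i ^+ m i.
  apply: eq_bigr => i /negPf ij.
  by rewrite tnth_mktuple ij scale0r addr0.
rewrite (big_ord_widen _ (fun i => ('X_j ^+ (m j - i) * y ^+ i) *+ 'C(m j, i))
  mD).
rewrite mulr_suml big_mkcond; apply: eq_bigr => l _ /=.
rewrite mderivnX ltnS; case: leqP => lm; last first.
  by rewrite ffact_small // scale0r scaler0 mul0r.
have eXm : 'X_[m - U_(j) *+ l] =
    'X_j ^+ (m j - l) * \prod_(i < n | i != j) 'X_i ^+ m i :> {mpoly K[n]}.
  rewrite mpolyXE_id (bigD1 j) //= mnmBE mulmnE mnm1E eqxx mul1n.
  congr (_ * _); apply: eq_bigr => i /negPf ij.
  by rewrite mnmBE mulmnE mnm1E eq_sym ij mul0n subn0.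
rewrite eXm scalerA.
have -> : l`!%:R^-1 * (m j ^_ l)%:R = 'C(m j, l)%:R :> K.
  by rewrite -bin_ffact natrM mulrCA mulVf ?mulr1 // natr_eq0 // -lt0n fact_gt0.
rewrite -scaler_nat -!scalerAl; congr (_ *: _).
by rewrite mulrAC.
Qed.

(** Any bound [D] is allowed, so that the sum can be padded with zero terms. *)
Lemma taylor j y p D : (msize p <= D)%N ->
  p \mPo shift_along (fun i => (i == j)%:R) y =
  \sum_(l < D) (l`!%:R^-1 *: p^`M(j, l)) * y ^+ l.
Proof.
move=> sp; rewrite comp_mpolyEX big_seq_cond.
under eq_bigr => m /andP[mp _].
  rewrite (@comp_shiftXm j y m D) ?scaler_sumr; first over.
  apply: leq_trans (leq_trans (msize_mdeg_lt mp) sp).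
  by rewrite ltnS mdegE (bigD1 j) //= leq_addr.
rewrite -big_seq_cond exchange_big /=; apply: eq_bigr => l _.
rewrite [in RHS](mpolyE p) linear_sum /= scaler_sumr mulr_suml.
apply: eq_bigr => m _; rewrite mderivmZ -!scalerAl !scalerA.
by congr (_ *: _); rewrite mulrC.
Qed.

End Taylor.

Notation omits k := (vars (predC1 k)).

(** * Affine automorphisms and shears *)

(** The identity is the default value when the two tuples are not mutually inverse. *)
HB.lock Definition mk_ga (K : fieldType) n (f f' : n.-tuple {mpoly K[n]}) :
  GA K n := odflt (1%g : GA K n) (insub (f, f') : option (GA K n)).

(* The substitution of [0] for [x_k] in [Q] makes [elem k Q] an automorphism
   for every [Q]; it does nothing when [Q] does not involve [x_k]. *)
HB.lock Definition elem (K : fieldType) n (k : 'I_n) (Q : {mpoly K[n]}) :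
  GA K n :=
  let Q0 := Q \mPo [tuple if i == k then 0 else 'X_i | i < n] in
  mk_ga [tuple if i == k then 'X_i + Q0 else 'X_i | i < n]
     [tuple if i == k then 'X_i - Q0 else 'X_i | i < n].

Section Automorphisms.
Context {K : fieldType} {n : nat}.
Implicit Types (p q P Q : {mpoly K[n]}) (f g h : GA K n) (i j k : 'I_n).

Lemma comp_gaM p f g :
  p \mPo comps (f * g)%g = (p \mPo comps f) \mPo comps g.
Proof. exact: comp_endo_mul. Qed.

Lemma comp_ga1 p : p \mPo comps (1%g : GA K n) = p.
Proof. exact: comp_mpoly_id. Qed.

Lemma comp_gaX i g : 'X_i \mPo comps g = g i.
Proof. exact: comp_mpolyXi. Qed.

Lemma comp_gaK g p : (p \mPo comps g) \mPo comps g^-1%g = p.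
Proof. by rewrite -comp_gaM mulgV comp_ga1. Qed.

Lemma comp_gaVK g p : (p \mPo comps g^-1%g) \mPo comps g = p.
Proof. by rewrite -comp_gaM mulVg comp_ga1. Qed.

Lemma ga_ext f g : (forall i, f i = g i) -> f = g.
Proof. by move=> fg; apply: comps_inj; apply: eq_from_tnth. Qed.

Lemma mk_gaE (f f' : n.-tuple {mpoly K[n]}) :
  (forall i, tnth f i \mPo f' = 'X_i) -> (forall i, tnth f' i \mPo f = 'X_i) ->
  forall i, mk_ga f f' i = tnth f i.
Proof.
move=> ff' f'f i; rewrite /component /comps mk_ga.unlock.
have eP : (endo_mul f f' == endo_one) && (endo_mul f' f == endo_one).
  by apply/andP; split; apply/eqP; apply: eq_from_tnth => j;
     rewrite !tnth_mktuple.
by case: insubP => [g _ /= -> | /negP].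
Qed.

Definition trans (v : 'I_n -> K) : GA K n :=
  mk_ga [tuple 'X_i + (v i)%:MP | i < n] [tuple 'X_i - (v i)%:MP | i < n].

Lemma transE v i : trans v i = 'X_i + (v i)%:MP.
Proof.
rewrite mk_gaE => [|j|j]; rewrite !tnth_mktuple //.
- by rewrite comp_mpolyD comp_mpolyC comp_mpolyXi tnth_mktuple subrK.
- by rewrite comp_mpolyB comp_mpolyC comp_mpolyXi tnth_mktuple addrK.
Qed.

Definition perm_ga (s : 'S_n) : GA K n :=
  mk_ga [tuple 'X_(s i) | i < n] [tuple 'X_(s^-1%g i) | i < n].

Lemma perm_gaE s i : perm_ga s i = 'X_(s i).
Proof.
rewrite mk_gaE => [|j|j]; rewrite !tnth_mktuple //.
- by rewrite comp_mpolyXi tnth_mktuple permK.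
- by rewrite comp_mpolyXi tnth_mktuple permKV.
Qed.

Definition diag_ga (d : 'I_n -> K) : GA K n :=
  mk_ga [tuple d i *: 'X_i | i < n] [tuple (d i)^-1 *: 'X_i | i < n].

Lemma diag_gaE d i : (forall j, d j != 0) -> diag_ga d i = d i *: 'X_i.
Proof.
move=> d0; rewrite mk_gaE => [|j|j]; rewrite !tnth_mktuple //.
- by rewrite comp_mpolyZ comp_mpolyXi tnth_mktuple scalerA mulfV ?scale1r.
- by rewrite comp_mpolyZ comp_mpolyXi tnth_mktuple scalerA mulVf ?scale1r.
Qed.

Definition aff (A : 'M[K]_n) (b : 'I_n -> K) : GA K n :=
  mk_ga [tuple \sum_j A i j *: 'X_j + (b i)%:MP | i < n]
     [tuple \sum_j invmx A i j *: ('X_j - (b j)%:MP) | i < n].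

Lemma sum_mxM (A B : 'M[K]_n) (F : 'I_n -> {mpoly K[n]}) i :
  \sum_j A i j *: (\sum_l B j l *: F l) = \sum_l (A *m B) i l *: F l.
Proof.
under eq_bigr do rewrite scaler_sumr.
rewrite exchange_big /=; apply: eq_bigr => l _.
rewrite mxE scaler_suml; apply: eq_bigr => j _.
by rewrite scalerA.
Qed.

Lemma sum_mx1 (F : 'I_n -> {mpoly K[n]}) i :
  \sum_l (1%:M : 'M[K]_n) i l *: F l = F i.
Proof.
rewrite (bigD1 i) //= mxE eqxx scale1r big1 ?addr0 // => j ji.
by rewrite mxE eq_sym (negPf ji) scale0r.
Qed.

Lemma affE A b i : A \in unitmx ->
  aff A b i = \sum_j A i j *: 'X_j + (b i)%:MP.
Proof.
move=> uA; rewrite mk_gaE => [|j|j]; rewrite !tnth_mktuple //.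
- rewrite comp_lin; under eq_bigr do rewrite tnth_mktuple.
  by rewrite sum_mxM mulmxV // sum_mx1 subrK.
- rewrite raddf_sum /=.
  under eq_bigr => l _ do
    rewrite comp_mpolyZ comp_mpolyB comp_mpolyC comp_mpolyXi tnth_mktuple addrK.
  by rewrite sum_mxM mulVmx // sum_mx1.
Qed.

Lemma elemE k Q i : omits k Q ->
  elem k Q i = if i == k then 'X_i + Q else 'X_i.
Proof.
move=> fQ; rewrite elem.unlock.
have -> : Q \mPo [tuple if i0 == k then 0 else 'X_i0 | i0 < n] = Q.
  by apply: comp_vars_id fQ _ => j /negPf jk; rewrite tnth_mktuple jk.
rewrite mk_gaE => [|j|j]; rewrite !tnth_mktuple //;
  case: (eqVneq j k) => [->|jk].
- rewrite comp_mpolyD comp_mpolyXi tnth_mktuple eqxx.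
  rewrite (comp_vars_id fQ) ?subrK // => l /negPf lk.
  by rewrite tnth_mktuple lk.
- by rewrite comp_mpolyXi tnth_mktuple (negPf jk).
- rewrite comp_mpolyB comp_mpolyXi tnth_mktuple eqxx.
  rewrite (comp_vars_id fQ) ?addrK // => l /negPf lk.
  by rewrite tnth_mktuple lk.
- by rewrite comp_mpolyXi tnth_mktuple (negPf jk).
Qed.

Lemma elemk k Q : omits k Q -> elem k Q k = 'X_k + Q.
Proof. by move/elemE ->; rewrite eqxx. Qed.

Lemma elem_neq k Q i : omits k Q -> i != k -> elem k Q i = 'X_i.
Proof. by move/elemE -> => /negPf ->. Qed.

Lemma comp_elem_id k Q P : omits k Q -> omits k P -> P \mPo comps (elem k Q) =
  P.
Proof.
by move=> fQ fP; apply: comp_vars_id fP _ => j jk; apply: elem_neq.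
Qed.

Lemma free_comp g k k' Q : omits k Q -> (forall j, j != k -> omits k' (g j)) ->
  omits k' (Q \mPo comps g).
Proof. by move=> fQ fg; apply: vars_comp fQ _. Qed.

(** This is the conjugation rule [g^-1 * elem k Q * g = elem k' (Q \mPo comps g)], the source of all
    new shears. *)
Lemma elem_mul g k k' Q : omits k Q -> g k = 'X_k' ->
  (forall j, j != k -> omits k' (g j)) ->
  (elem k Q * g = g * elem k' (Q \mPo comps g))%g.
Proof.
move=> fQ gk fg; have fQg := free_comp fQ fg.
apply: ga_ext => i; rewrite !ga_mulE; case: (eqVneq i k) => [->|ik].
  by rewrite (elemk fQ) gk comp_mpolyD !comp_gaX gk (elemk fQg).
by rewrite (elem_neq fQ ik) comp_gaX (comp_elem_id fQg (fg i ik)).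
Qed.

Lemma elemD k P Q : omits k P -> omits k Q ->
  (elem k P * elem k Q = elem k (P + Q))%g.
Proof.
move=> fP fQ; have fPQ := varsD fP fQ.
apply: ga_ext => i; rewrite ga_mulE; case: (eqVneq i k) => [->|ik].
  rewrite (elemk fP) (elemk fPQ) comp_mpolyD comp_gaX (elemk fQ).
  by rewrite (comp_elem_id fQ fP) -addrA (addrC Q).
by rewrite (elem_neq fP ik) (elem_neq fPQ ik) comp_gaX (elem_neq fQ ik).
Qed.

Lemma elem0 k : elem k 0 = 1%g :> GA K n.
Proof.
apply: ga_ext => i; rewrite elemE; last exact: vars0.
by rewrite ga_oneE addr0 if_same.
Qed.

Lemma comp_neq_const g i c : g i <> c%:MP.
Proof.
move=> gic; have := comp_gaK g 'X_i; rewrite comp_gaX gic comp_mpolyC.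
move/(congr1 (mcoeff U_(i))); rewrite mcoeffC mcoeffXU eqxx mnm1_eq0 mulr0.
by move/eqP; rewrite eq_sym oner_eq0.
Qed.

(** The lower bound on the degree is automatic, because no component of an automorphism is
    constant. *)
Lemma affineP g : (forall i, (msize (g i) <= 2)%N) <-> affine g.
Proof.
split=> [sg i|ag i]; last by rewrite ag.
apply/eqP; rewrite eqn_leq sg ltnNge; apply/negP => /mpoly_const.
exact: comp_neq_const.
Qed.

Lemma affine_msize2 g i : affine g -> (msize (g i) <= 2)%N.
Proof. by move->. Qed.

Lemma affineM f g : affine f -> affine g -> affine (f * g)%g.
Proof.
move=> af ag; apply/affineP => i; rewrite ga_mulE; apply: msize2_comp.
  exact: affine_msize2.
by move=> j; apply: affine_msize2.
Qed.

Lemma affine1 : affine (1%g : GA K n).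
Proof. by move=> i; rewrite ga_oneE msizeX mdeg1. Qed.

Lemma msize2X i : (msize ('X_i : {mpoly K[n]}) <= 2)%N.
Proof. by rewrite msizeX mdeg1. Qed.

Lemma msize2C c : (msize (c%:MP : {mpoly K[n]}) <= 2)%N.
Proof. by rewrite msizeC; case: eqP. Qed.

Lemma affine_aff A b : A \in unitmx -> affine (aff A b).
Proof. by move=> uA; apply/affineP => i; rewrite affE // msize_lin. Qed.

Lemma affine_trans v : affine (trans v).
Proof.
apply/affineP => i; rewrite transE.
by apply: (subspaceD msize2_subspace); [apply: msize2X | apply: msize2C].
Qed.

Lemma affine_perm s : affine (perm_ga s).
Proof. by move=> i; rewrite perm_gaE msizeX mdeg1. Qed.

Lemma affine_diag d : (forall j, d j != 0) -> affine (diag_ga d).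
Proof.
move=> d0; apply/affineP => i; rewrite diag_gaE //.
by apply: (subspaceZ _ msize2_subspace); apply: msize2X.
Qed.

Lemma affine_elem k Q : omits k Q -> (msize Q <= 2)%N -> affine (elem k Q).
Proof.
move=> fQ sQ; apply/affineP => i; rewrite elemE //; case: eqP => _.
  by apply: (subspaceD msize2_subspace) => //; apply: msize2X.
exact: msize2X.
Qed.

(** Composing with [g^-1] turns a relation between 1 and the components into one between 1 and the
    variables. *)
Lemma comps_free g (l : 'I_n -> K) c :
  \sum_i l i *: g i = c%:MP -> forall i, l i = 0.
Proof.
move=> lg i; have : (\sum_i l i *: g i) \mPo comps g^-1%g = c%:MP.
  by rewrite lg comp_mpolyC.
rewrite raddf_sum /=.
under eq_bigr => j _ do rewrite comp_mpolyZ -comp_gaX comp_gaK.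
move/(congr1 (mcoeff U_(i))); rewrite -[\sum_i _]addr0 -(mpolyC0 n K).
by rewrite mcoeffU_lin mcoeffC mnm1_eq0 mulr0.
Qed.

(** A row vector killed by [A] makes the corresponding combination of the [q i] constant, hence is
    zero. *)
Lemma indep_unitmx (q r : 'I_n -> {mpoly K[n]}) (A : 'M[K]_n) (b : 'I_n -> K) :
  (forall i, q i = \sum_j A i j *: r j + (b i)%:MP) ->
  (forall (l : 'I_n -> K) c, \sum_i l i *: q i = c%:MP -> forall i, l i = 0) ->
  A \in unitmx.
Proof.
move=> qE q_indep; rewrite -row_free_unit -kermx_eq0;
  apply/eqP/row_matrixP => i.
rewrite row0; set l := row i _.
have lA : l *m A = 0 by apply/sub_kermxP/row_sub.
apply/rowP => j; rewrite [RHS]mxE.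
apply: (q_indep (fun j => l ord0 j) (\sum_j l ord0 j * b j)).
under eq_bigr do rewrite qE scalerDr.
rewrite big_split /= raddf_sum /=.
under [X in _ + X]eq_bigr do rewrite -mul_mpolyC -mpolyCM.
rewrite -[RHS]add0r; congr (_ + _).
under eq_bigr do rewrite scaler_sumr.
rewrite exchange_big big1 //= => m _.
under eq_bigr do rewrite scalerA.
rewrite -scaler_suml; move/matrixP/(_ ord0 m): lA; rewrite !mxE => ->.
by rewrite scale0r.
Qed.

Lemma affine_mxP g : affine g ->
  exists A b, A \in unitmx /\
    forall i, g i = \sum_j A i j *: 'X_j + (b i)%:MP.
Proof.
move=> ag.
pose A : 'M[K]_n := \matrix_(i, j) (g i)@_U_(j).
pose b i := (g i)@_0%MM.
have gE i : g i = \sum_j A i j *: 'X_j + (b i)%:MP.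
  rewrite {1}(mpoly_lin (affine_msize2 i ag)); congr (_ + _).
  by apply: eq_bigr => j _; rewrite mxE.
by exists A, b; split=> //; apply: indep_unitmx gE _ => l c; apply: comps_free.
Qed.

Lemma affineV g : affine g -> affine g^-1%g.
Proof.
move=> /affine_mxP[A [b [uA gE]]]; apply/affineP => i.
have gV j : \sum_l A j l *: (g^-1%g : GA K n) l = 'X_j - (b j)%:MP.
  apply/eqP; rewrite eq_sym subr_eq; apply/eqP.
  by rewrite -[LHS](comp_gaK g) comp_gaX gE comp_lin.
rewrite -(sum_mx1 (fun i => (g^-1%g : GA K n) i)) -(mulVmx uA) -sum_mxM.
apply: (subspace_sum _ msize2_subspace) => j _; rewrite gV.
apply: (subspaceZ _ msize2_subspace).
by apply: (subspaceB msize2_subspace); [apply: msize2X | apply: msize2C].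
Qed.

End Automorphisms.

(** * Derivatives and monomials *)

Section MpolyFacts.
Context {K : fieldType} {n : nat}.
Implicit Types (p q P Q : {mpoly K[n]}) (i j k : 'I_n) (m : 'X_{1..n}).

Lemma mnm_neq0 m : (0 < mdeg m)%N -> exists j, (0 < m j)%N.
Proof.
move=> dm; apply/existsP; apply: contraTT dm; rewrite negb_exists -eqn0Ngt.
move/forallP => m0; rewrite mdegE big1 // => j _.
by move: (m0 j); rewrite -eqn0Ngt => /eqP.
Qed.

Lemma msize_mderiv j p : p != 0 -> (msize p^`M(j) < msize p)%N.
Proof.
move=> p0; have p1 : (0 < msize p)%N by rewrite lt0n msize_poly_eq0.
rewrite -(prednK p1) ltnS msizeE; apply/bigmax_leqP_seq => m md _.
rewrite -ltnS (prednK p1).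
have : (m + U_(j))%MM \in msupp p.
  rewrite mcoeff_msupp; apply: contraTneq md => pm.
  by rewrite mcoeff_msupp mcoeff_mderiv pm mul0rn eqxx.
by move/msize_mdeg_lt; rewrite mdegD mdeg1 addn1.
Qed.

Lemma mderiv_free k p : omits k p -> p^`M(k) = 0.
Proof.
move=> fp; apply/mpolyP => m; rewrite mcoeff_mderiv mcoeff0.
rewrite memN_msupp_eq0 ?mul0rn //; apply/negP => mp.
by move: (fp _ k mp); rewrite /= eqxx mnmDE mnm1E eqxx addn1 => /(_ isT).
Qed.

Lemma third i j : (3 <= n)%N -> exists c, c != i /\ c != j.
Proof.
move=> n3; have : (#|[set i; j]| < #|'I_n|)%N.
  by rewrite cardsU1 cards1 card_ord; case: (_ \notin _) => //; apply: ltnW.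
rewrite -cardsT ltnNge => nle.
have /subsetPn[c _] : ~~ ([set: 'I_n] \subset [set i; j]).
  by apply: contra nle => /subset_leq_card.
by rewrite !inE negb_or => /andP[ci cj]; exists c.
Qed.

Lemma mderivXU i j : ('X_i : {mpoly K[n]})^`M(j) = (i == j)%:R%:MP.
Proof.
rewrite mderivX mnm1E; case: eqP => [->|_]; last by rewrite scale0r mpolyC0.
by rewrite scale1r -{1}[U_(j)%MM]add0m addmK mpolyX0.
Qed.

Lemma in_first_varsE (r : nat) p :
  in_first_vars r p <-> vars (fun j : 'I_n => (j < r)%N) p.
Proof.
split=> vp m j mp; first by rewrite -leqNgt; apply: vp.
by rewrite leqNgt; apply: vp.
Qed.

End MpolyFacts.

(** * Generation of the tame group *)

Section Generation.
Context {K : fieldType} (charK : [pchar K]%R =i pred0).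
Context {n : nat} (n_ge3 : (3 <= n)%N).
Implicit Types (p q P Q : {mpoly K[n]}) (g : GA K n) (i j k c : 'I_n).

Context (G : GA K n -> Prop).
Hypotheses (Gaff : forall g, affine g -> G g)
  (GM : forall f g, G f -> G g -> G (f * g)%g)
  (GV : forall g, G g -> G g^-1%g).

(** [G] is any subgroup containing the affine maps; it will be the one generated by [phi] and the
    affine group. *)
Definition shears k Q := omits k Q /\ G (elem k Q).

Lemma shears_lin k Q : omits k Q -> (msize Q <= 2)%N -> shears k Q.
Proof. by move=> fQ sQ; split=> //; apply/Gaff/affine_elem. Qed.

Lemma shears_comp g k k' Q : shears k Q -> G g -> g k = 'X_k' ->
  (forall j, j != k -> omits k' (g j)) -> shears k' (Q \mPo comps g).
Proof.
move=> [fQ GQ] Gg gk fg; split; first exact: free_comp fQ fg.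
have := elem_mul fQ gk fg => /(congr1 (fun h => g^-1 * h)%g);
  rewrite mulKg => <-.
by apply: GM; [apply: GV | apply: GM].
Qed.

Lemma shears_subspace k : subspace (shears k).
Proof.
have S0 : shears k 0 by apply: shears_lin; [apply: vars0 | rewrite msize0].
split=> // c p q Sp [fq Gq].
suff [fcp Gcp] : shears k (c *: p).
  by split; [apply: varsD | rewrite -elemD //; apply: GM].
have [->|c0] := eqVneq c 0; first by rewrite scale0r.
case: Sp => fp Gp; have fcp : omits k (c *: p) by apply: varsZ.
split=> //.
(* Conjugation by the dilation of ['X_k] by [c^-1] multiplies the shear polynomial by [c]. *)
pose d i := if i == k then c^-1 else 1.
have d0 i : d i != 0 by rewrite /d; case: ifP; rewrite ?oner_eq0 ?invr_eq0.
have -> : elem k (c *: p) = ((diag_ga d)^-1 * (elem k p * diag_ga d))%g.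
  apply: (can_inj (mulKg (diag_ga d))); rewrite mulVKg; apply: ga_ext => i.
  rewrite !ga_mulE (diag_gaE _ d0) comp_mpolyZ comp_gaX.
  have [->|ik] := eqVneq i k.
    rewrite (elemk fcp) (elemk fp) comp_mpolyD comp_gaX (diag_gaE _ d0).
    rewrite scalerDr /d eqxx scalerA mulVf // scale1r; congr (_ + _).
    rewrite (comp_vars_id fp) // => j jk.
    by rewrite -/(component _ j) (diag_gaE _ d0) /d (negPf jk) scale1r.
  rewrite (elem_neq fcp ik) (elem_neq fp ik) comp_gaX (diag_gaE _ d0).
  by [].
by apply: GM; [apply/GV/Gaff/affine_diag | apply: GM => //;
  apply/Gaff/affine_diag].
Qed.

(** Conjugating by the affine shear that adds [r y] to ['X_j] gives the Taylor expansion of [Q] in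
    powers of [r]; its linear coefficient can be extracted because [shears k] is a subspace. *)
Lemma shears_mderiv k j (y : {mpoly K[n]}) Q : shears k Q -> j != k ->
  vars [pred i | (i != k) && (i != j)] y -> (msize y <= 2)%N ->
  shears k (y * Q^`M(j)).
Proof.
move=> SQ jk vy sy.
have fjy : omits j y by apply: sub_vars vy => i /andP[].
have fky : omits k y by apply: sub_vars vy => i /andP[].
pose f l := (l`!%:R^-1 *: Q^`M(j, l)) * y ^+ l.
(* Two extra terms keep the index 1 in range even when [Q] is zero. *)
have Sf (r : nat) : shears k (\sum_(l < (msize Q).+2) r.+1%:R ^+ l *: f l).
  pose g := elem j (r.+1%:R *: y).
  have fjr : omits j (r.+1%:R *: y) by apply: varsZ.
  have -> : \sum_(l < (msize Q).+2) r.+1%:R ^+ l *: f l = Q \mPo comps g.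
    have -> : comps g = shift_along (fun i => (i == j)%:R) (r.+1%:R *: y).
      apply: eq_from_tnth => i; rewrite tnth_mktuple -/(component g i).
      rewrite (elemE _ fjr); case: eqP => _; first by rewrite scale1r.
      by rewrite scale0r addr0.
    rewrite (taylor charK j _ (leq_trans (leqnSn _) (leqnSn (msize Q).+1))).
    by apply: eq_bigr => l _; rewrite exprZn scalerAr.
  apply: (shears_comp SQ) => [||i ik].
  - apply/Gaff/affine_elem => //.
    exact: (subspaceZ _ msize2_subspace).
  - by rewrite (elem_neq fjr) // eq_sym.
  - rewrite (elemE _ fjr); case: eqP => _; last exact: varsX.
    by apply: varsD; [apply: varsX | apply: varsZ].
have := coef_subspace charK (shears_subspace k) Sf (isT : (1 < (msize Q).+2)%N).
by rewrite /f invr1 scale1r mulm1n mderivmU1m expr1 mulrC.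
Qed.

Lemma vars_neq2X k j i : i != k -> i != j ->
  vars [pred i | (i != k) && (i != j)] ('X_i : {mpoly K[n]}).
Proof. by move=> ik ij; apply: varsX; rewrite /= ik. Qed.

Lemma shears_polarize k i j Q : i != k -> j != k -> i != j ->
  shears k Q -> shears k ('X_i * Q^`M(j)).
Proof.
move=> ik jk ij SQ; apply: shears_mderiv => //; first exact: vars_neq2X.
exact: msize2X.
Qed.

(** Differentiation lowers [Q] to degree two, and the operators ['X_i] times the derivative along
    ['X_j] then turn the quadratic part into a square. *)
Lemma shears_square k Q : shears k Q -> (2 < msize Q)%N ->
  exists2 c, c != k & shears k ('X_c ^+ 2).
Proof.
have [d] := ubnP (msize Q); elim: d Q => // d IHd Q sQ SQ Q2.
have Q0 : Q != 0 by apply: contraTneq Q2 => ->; rewrite msize0.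
case: (boolP [exists j, (j != k) && (2 < msize Q^`M(j))%N]) => [/existsP[j]|].
  case/andP=> jk dQ2; apply: (IHd Q^`M(j)) => //.
    by rewrite -ltnS (leq_trans _ sQ) // ltnS msize_mderiv.
  rewrite -[Q^`M(j)]mul1r; apply: shears_mderiv => //.
    exact: (varsC (c := 1)). by rewrite msize1.
rewrite negb_exists => /forallP dQ2.
have {}dQ2 j : (msize Q^`M(j) <= 2)%N.
  have [->|jk] := eqVneq j k; first by rewrite mderiv_free ?msize0 //; case: SQ.
  by move: (dQ2 j); rewrite jk /= -leqNgt.
have cQ a b : Q^`M(a)^`M(b) = (Q^`M(a)^`M(b)@_0)%:MP.
  apply: mpoly_const; have [->|da] := eqVneq Q^`M(a) 0.
    by rewrite mderiv0 msize0.
  by rewrite -ltnS (leq_trans (msize_mderiv b da)).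
(* All second derivatives are now constant, and the leading monomial gives [a], [b] with a nonzero
   one. If [a = b], take [R = Q]; otherwise [R] is ['X_b] times the derivative of [Q] along ['X_a],
   whose second derivative along ['X_b] is twice that constant. *)
have [b [c [bk c0 SR]]] : exists (b : 'I_n) (c : K), [/\ b != k, c != 0 &
    exists2 R, shears k R & R^`M(b)^`M(b) = c%:MP].
  pose m := mlead Q; have mQ : m \in msupp Q by apply: mlead_supp.
  have dm : (1 < mdeg m)%N by rewrite -ltnS mlead_deg.
  have [a ma] := mnm_neq0 (ltnW dm).
  have eqma : ((m - U_(a)) + U_(a))%MM = m.
    by rewrite submK // lep1mP -lt0n.
  have dm' : (0 < mdeg (m - U_(a))%MM)%N.
    by move: dm; rewrite -{1}eqma mdegD mdeg1 addn1.
  have [b mb] := mnm_neq0 dm'.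
  have eqmb : ((m - U_(a) - U_(b)) + U_(b))%MM = (m - U_(a))%MM.
    by rewrite submK // lep1mP -lt0n.
  have neqk l : (0 < m l)%N -> l != k.
    move=> ml; apply: contraTneq ml => ->; case: SQ => fQ _.
    have mk0 : m k = 0%N by apply: fQ mQ _; rewrite /= eqxx.
    by rewrite mk0.
  have ak := neqk a ma.
  have bk : b != k.
    by apply: neqk; rewrite -eqma mnmDE ltn_addr.
  have c0 : Q^`M(a)^`M(b)@_0 != 0.
    apply/eqP => c0; move: (cQ a b); rewrite c0 => /(congr1 (mcoeff (m - U_(a)
      - U_(b))%MM)).
    rewrite mpolyC0 mcoeff0 !mcoeff_mderiv eqmb eqma -mulrnA => /eqP.
    by rewrite -mulr_natr mulf_eq0 natr_eq0 // muln_eq0 /= orbF mcoeff_eq0 mQ.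
  have [ab|ab] := eqVneq a b.
    exists a, (Q^`M(a)^`M(b)@_0); split=> //; exists Q => //.
    by rewrite -cQ -ab.
  exists b, (Q^`M(a)^`M(b)@_0 *+ 2); split=> //.
    by rewrite -mulr_natr mulf_neq0 // natr_eq0.
  exists ('X_b * Q^`M(a)); first by apply: shears_polarize => //;
    rewrite eq_sym.
  have := cQ a b; set e := _@_0 => dQ.
  rewrite mderivM mderivXU eqxx mul1r mderivD mderivM dQ mderivC mulr0 addr0.
  by rewrite mderivXU eqxx mul1r -mulr2n mpolyCMn.
(* Differentiating along ['X_b] and multiplying by ['X_e], twice in a row, sends [R] to
   [c *: 'X_e ^+ 2]. *)
case: SR => R SR dR; have [e [ek eb]] := third k b n_ge3.
exists e => //; have := shears_polarize ek bk eb (shears_polarize ek bk eb SR).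
rewrite mderivM mderivXU (negPf eb) mul0r add0r dR mulrA -expr2 mulrC.
rewrite mul_mpolyC => /(subspaceZ c^-1 (shears_subspace k)).
by rewrite scalerA mulVf // scale1r.
Qed.

Lemma shears_perm (s : 'S_n) k Q :
  shears k Q -> shears (s k) (Q \mPo comps (perm_ga s)).
Proof.
move=> SQ; apply: shears_comp SQ _ _ _; first exact/Gaff/affine_perm.
  exact: perm_gaE.
move=> j jk; rewrite perm_gaE; apply: varsX.
by rewrite /= (inj_eq perm_inj).
Qed.

Hypothesis square : exists k c, c != k /\ shears k ('X_c ^+ 2).

Lemma shears_all_squares k c : c != k -> shears k ('X_c ^+ 2).
Proof.
case: square => k0 [c0 [c0k0 S0]] ck.
have := shears_perm (tperm k0 k) S0.
rewrite tpermL rmorphXn /= comp_gaX perm_gaE.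
set c1 := tperm k0 k c0 => S1.
have c1k : c1 != k by rewrite -[X in _ != X](tpermL k0 k) (inj_eq perm_inj).
have := shears_perm (tperm c1 c) S1.
by rewrite rmorphXn /= comp_gaX perm_gaE tpermL tpermD.
Qed.

Lemma shears_mul2 k i c : i != k -> c != k -> i != c ->
  shears k ('X_i * 'X_c).
Proof.
move=> ik ck ic; have := shears_polarize ik ck ic (shears_all_squares ck).
rewrite expr2 mderivM mderivXU eqxx mulr1 mul1r -mulr2n -scaler_nat.
rewrite -scalerAr => /(subspaceZ 2%:R^-1 (shears_subspace k)).
by rewrite scalerA mulVf ?scale1r // natr_eq0.
Qed.

(* Substituting [x_c + Q] for [x_c] in [x_i x_c] raises degrees. *)
Lemma shears_expn k i d : i != k -> shears k ('X_i ^+ d).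
Proof.
elim: d k => [|d IHd] k ik.
  rewrite expr0; apply: shears_lin; first exact: (varsC (c := 1)).
  by rewrite msize1.
have [c [ck ci]] := third k i n_ge3.
have ic : i != c by rewrite eq_sym.
have [fQ GQ] := IHd c ic.
have := shears_comp (shears_mul2 ik ck ic) GQ.
move/(_ k); rewrite (elem_neq fQ) 1?eq_sym // => /(_ erefl).
rewrite rmorphM /= !comp_gaX (elemk fQ) (elem_neq fQ ic) mulrDr -exprS => SD.
rewrite -[_ ^+ _](addKr ('X_i * 'X_c)) addrC.
apply: (subspaceB (shears_subspace k)); last exact: shears_mul2.
apply: SD => j jk; rewrite (elemE _ fQ); case: eqP => _; last exact: varsX.
by apply: varsD; [apply: varsX | apply: varsXn; apply: varsX].
Qed.

(** Induction on the degree in the variables other than ['X_c]. Replacing one factor ['X_j] by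
    ['X_c] lowers it, and polarising back recovers the monomial up to the nonzero factor [m c + 1].
    Pure powers of ['X_c] are the base case. *)
Lemma shears_monomial k (m : 'X_{1..n}) : m k = 0%N -> shears k 'X_[m].
Proof.
have [c [ck _]] := third k k n_ge3.
have [e] := ubnP (mdeg m - m c); elim: e m => // e IHe m me mk.
case: (boolP [exists j, (j != c) && (m j != 0%N)]) => [/existsP[j]|];
  last first.
  rewrite negb_exists => /forallP m0.
  have -> : m = (U_(c) *+ m c)%MM.
    apply/mnmP => j; rewrite mulmnE mnm1E; have := m0 j.
    have [->|jc] := eqVneq j c; first by rewrite mul1n.
    by rewrite mul0n negbK => /eqP.
  by rewrite -mpolyXn; apply: shears_expn.
case/andP=> jc mj.
have jk : j != k by apply: contraNneq mj => ->; rewrite mk.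
pose m1 := (m - U_(j))%MM; pose m' := (m1 + U_(c))%MM.
have em : (m1 + U_(j))%MM = m by rewrite submK // lep1mP.
have m'c : m' c = (m c).+1.
  by rewrite mnmDE mnmBE !mnm1E eqxx (negPf jc) subn0 addn1.
have Sm' : shears k 'X_[m'].
  apply: IHe; last first.
    by rewrite mnmDE mnmBE !mnm1E mk (negPf ck) sub0n.
  rewrite m'c -ltnS (leq_trans _ me) // ltnS.
  have -> : mdeg m' = mdeg m by rewrite -[in RHS]em !mdegD !mdeg1.
  apply: ltn_sub2l => //; rewrite -[in X in (_ < X)%N]em mdegD mdeg1 addn1 ltnS.
  have -> : m c = m1 c by rewrite mnmBE mnm1E (negPf jc) subn0.
  by rewrite mdegE (bigD1 c) //= leq_addr.
have := shears_polarize jk ck jc Sm'.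
rewrite mderivX addmK m'c -scalerAr -mpolyXD addmC em.
move/(subspaceZ (m c).+1%:R^-1 (shears_subspace k)).
by rewrite scalerA mulVf ?scale1r // natrS_neq0.
Qed.

Lemma shears_free k Q : omits k Q -> shears k Q.
Proof.
move=> fQ; rewrite (mpolyE Q) big_seq_cond.
apply: (subspace_sum _ (shears_subspace k)) => m /andP[mQ _].
apply: (subspaceZ _ (shears_subspace k)); apply: shears_monomial.
by apply: fQ mQ _; rewrite /= eqxx.
Qed.

Lemma triangular_gen g : triangular g -> G g.
Proof.
case=> u [P [u0 vP gE]].
have {}vP i : vars (fun j : 'I_n => (j < i)%N) (P i).
  by apply/in_first_varsE.
(* The components of index at least [r] are diagonal; composing with a shear in the variable of
   index [r - 1] clears one more component and leaves the lower ones unchanged, as they do not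
   involve that variable. *)
suff H r (f : GA K n) (R : 'I_n -> {mpoly K[n]}) :
    (forall i, f i = u i *: 'X_i + R i) ->
    (forall i, vars (fun j : 'I_n => (j < i)%N) (R i)) ->
    (forall i : 'I_n, (r <= i)%N -> R i = 0) -> G f.
  by apply: (H n _ _ gE vP) => i; rewrite leqNgt ltn_ord.
elim: r f R {P gE vP} => [|r IHr] f P fE vP P0.
  suff -> : f = diag_ga u by apply/Gaff/affine_diag.
  by apply: ga_ext => i; rewrite diag_gaE // fE P0 ?addr0.
have [rn|rn] := ltnP r n; last first.
  by apply: (IHr _ P fE vP) => i; rewrite leqNgt (leq_trans _ rn).
pose k := Ordinal rn; pose Q := (u k)^-1 *: P k.
have fQ : omits k Q.
  apply: varsZ; apply: sub_vars (vP k) => j /= jk.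
  by rewrite -val_eqE neq_ltn jk.
have fmQ : omits k (- Q) by apply: varsN.
suff Gf : G (f * elem k (- Q))%g.
  have -> : f = ((f * elem k (- Q)) * elem k Q)%g.
    by rewrite -mulgA elemD // addNr elem0 mulg1.
  by apply: GM => //; case: (shears_free fQ).
apply: (IHr _ (fun i => if i == k then 0 else P i)) => [i|i|i ri]; last first.
- case: eqVneq => // ik; apply: P0.
  by rewrite ltn_neqAle ri andbT eq_sym; move: ik; rewrite -val_eqE.
- by case: eqP => // _; apply: vars0.
rewrite ga_mulE fE comp_mpolyD comp_mpolyZ comp_gaX; case: eqVneq => [->|ik].
  rewrite (elemk fmQ) scalerDr scalerN scalerA mulfV // scale1r addr0.
  rewrite comp_elem_id // ?subrK //; apply: sub_vars (vP k) => j /= jk.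
  by rewrite -val_eqE neq_ltn jk.
rewrite (elem_neq fmQ ik); congr (_ + _).
case: (ltnP i r) => ir; last first.
  rewrite P0 ?comp_mpoly0 // ltn_neqAle ir andbT eq_sym.
  by move: ik; rewrite -val_eqE.
apply: comp_elem_id => //; apply: sub_vars (vP i) => j /= ji.
by rewrite -val_eqE neq_ltn (ltn_trans ji ir).
Qed.

End Generation.

(** * Co-tameness and affine factors *)

Section Cotame.
Context {K : fieldType} (charK : [pchar K]%R =i pred0).
Context {n : nat} (n_ge3 : (3 <= n)%N).
Implicit Types (phi psi : GA K n) (k : 'I_n).

Definition gen_aff phi : GA K n -> Prop :=
  generated (fun chi => chi = phi \/ affine chi).

Lemma gen_aff_self phi : gen_aff phi phi.
Proof. by apply: gen_incl; left. Qed.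

Lemma gen_aff_affine phi psi : affine psi -> gen_aff phi psi.
Proof. by move=> ap; apply: gen_incl; right. Qed.

Lemma cotame_elem phi k Q : omits k Q -> (2 < msize Q)%N ->
  gen_aff phi (elem k Q) -> cotame phi.
Proof.
move=> fQ sQ GQ.
have Gaff := @gen_aff_affine phi.
have GM : forall f g, gen_aff phi f -> gen_aff phi g -> gen_aff phi (f * g)%g.
  by move=> f g; apply: gen_mul.
have GV : forall g, gen_aff phi g -> gen_aff phi g^-1%g.
  by move=> g; apply: gen_inv.
have sq : exists k c, c != k /\ shears (gen_aff phi) k ('X_c ^+ 2).
  have SQ : shears (gen_aff phi) k Q by split.
  have [c ck Sc] := shears_square charK n_ge3 Gaff GM GV SQ sQ.
  by exists k, c.
move=> psi; elim=> [x [ax|tx]||x y _ Gx _ Gy|x _ Gx].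
- exact: Gaff.
- exact: (triangular_gen charK n_ge3 Gaff GM GV sq tx).
- exact: gen_one.
- exact: GM.
- exact: GV.
Qed.

Lemma cotame_gen phi psi : gen_aff phi psi -> cotame psi -> cotame phi.
Proof.
move=> Gpsi Cpsi chi /Cpsi; elim=> [x [->//|ax]||x y _ Gx _ Gy|x _ Gx].
- exact: gen_aff_affine.
- exact: gen_one.
- exact: gen_mul.
- exact: gen_inv.
Qed.

Definition affine_or_cotame phi := affine phi \/ cotame phi.

Lemma affine_or_cotameMl alpha phi : affine alpha ->
  affine_or_cotame (alpha * phi)%g -> affine_or_cotame phi.
Proof.
move=> aa [ap|Cp]; [left|right].
  by rewrite -(mulKg alpha phi); apply: affineM => //; apply: affineV.
apply: cotame_gen Cp; apply: gen_mul; last exact: gen_aff_self.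
exact: gen_aff_affine.
Qed.

Lemma affine_or_cotameMr alpha phi : affine alpha ->
  affine_or_cotame (phi * alpha)%g -> affine_or_cotame phi.
Proof.
move=> aa [ap|Cp]; [left|right].
  by rewrite -(mulgK alpha phi); apply: affineM => //; apply: affineV.
apply: cotame_gen Cp; apply: gen_mul; first exact: gen_aff_self.
exact: gen_aff_affine.
Qed.

Lemma affine_or_cotameV phi :
  affine_or_cotame phi^-1%g -> affine_or_cotame phi.
Proof.
move=> [ap|Cp]; [left|right]; first by rewrite -[phi]invgK; apply: affineV.
by apply: cotame_gen Cp; apply: gen_inv; apply: gen_aff_self.
Qed.

End Cotame.

(** Transitivity of the general linear group on nonzero vectors: a linear map preserving the rank of
    [x] agrees on [x] with an invertible one. *)
Lemma unitmx_row (K : fieldType) n (x y : 'rV[K]_n) : x != 0 -> y != 0 ->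
  exists2 A : 'M[K]_n, A \in unitmx & x *m A = y.
Proof.
move=> x0 y0; have /rV0Pn[i0 xi0] := x0.
pose f : 'M[K]_n := \matrix_(i, j) (if i == i0 then (x ord0 i0)^-1 * y ord0 j
  else 0).
have xf : x *m f = y.
  apply/rowP => j; rewrite mxE (bigD1 i0) //= mxE eqxx mulVKf //.
  by rewrite big1 ?addr0 // => i /negPf ii0; rewrite mxE ii0 mulr0.
have : \rank (x *m f) = \rank x by rewrite xf !rank_rV x0 y0.
by case/complete_unitmx => A uA; rewrite xf => yA; exists A.
Qed.

(** * Translations and the automorphisms that commute with them *)

Section Translations.
Context {K : fieldType} {n : nat}.
Implicit Types (p q : {mpoly K[n]}) (f g : GA K n) (v w : 'I_n -> K)
  (i j k : 'I_n).

Definition along k (s : K) : 'I_n -> K := fun i => if i == k then s else 0.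

Lemma eq_trans v w : v =1 w -> trans v = trans w.
Proof. by move=> vw; apply: ga_ext => i; rewrite !transE vw. Qed.

Lemma transD v w : (trans v * trans w)%g = trans (fun i => v i + w i).
Proof.
apply: ga_ext => i; rewrite ga_mulE !transE comp_mpolyD comp_mpolyC comp_gaX.
by rewrite transE addrAC -addrA -mpolyCD.
Qed.

Lemma comps_along k s :
  comps (trans (along k s)) = shift_along (fun i => (i == k)%:R) s%:MP.
Proof.
apply: eq_from_tnth => i; rewrite tnth_mktuple -/(component _ i) transE /along.
by case: eqP => _; rewrite ?scale1r // scale0r mpolyC0.
Qed.

Lemma trans_mulE v g i : (trans v * g)%g i = g i + (v i)%:MP.
Proof. by rewrite ga_mulE transE comp_mpolyD comp_mpolyC comp_gaX. Qed.

Lemma omits_along k p s : omits k p -> p \mPo comps (trans (along k s)) = p.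
Proof.
move=> op; apply: comp_vars_id op _ => j /negPf jk.
by rewrite -/(component _ j) transE /along jk mpolyC0 addr0.
Qed.

Lemma aff_trans (A : 'M[K]_n) b v : A \in unitmx ->
  (aff A b * trans v)%g = (trans (fun i => \sum_j A i j * v j) * aff A b)%g.
Proof.
move=> uA; apply: ga_ext => i; rewrite trans_mulE ga_mulE !affE // comp_lin.
rewrite -addrA [_%:MP + _%:MP]addrC addrA; congr (_ + _).
rewrite raddf_sum -big_split /=; apply: eq_bigr => j _.
rewrite -/(component _ j) transE scalerDr; congr (_ + _).
by rewrite mpolyCM mul_mpolyC.
Qed.

Lemma affine_trans_conj g v : affine g ->
  exists w, (g * trans v)%g = (trans w * g)%g.
Proof.
case/affine_mxP => A [b [uA gE]]; exists (fun i => \sum_j A i j * v j).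
by have -> : g = aff A b; [apply: ga_ext => i;
  rewrite gE affE | apply: aff_trans].
Qed.

Hypothesis charK : [pchar K]%R =i pred0.

Lemma mderiv0_omits k p : p^`M(k) = 0 -> omits k p.
Proof.
move=> dp m j mp; rewrite /= negbK => /eqP ->; apply/eqP.
rewrite -[_ == _]negbK -lt0n; apply/negP => mk.
have em : (m - U_(k) + U_(k))%MM = m by rewrite submK // lep1mP -lt0n.
have /eqP := congr1 (mcoeff (m - U_(k))%MM) dp.
rewrite mcoeff0 mcoeff_mderiv em -mulr_natr mulf_eq0.
by rewrite (negPf (natrS_neq0 charK _)) orbF mcoeff_eq0 mp.
Qed.

(** Invariance under the unit translation gives invariance under all integral ones, so in
    characteristic zero every Taylor coefficient of positive order vanishes, in particular the
    derivative. *)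
Lemma along_invariant_omits k p :
  p \mPo comps (trans (along k 1)) = p -> omits k p.
Proof.
move=> pt; apply: mderiv0_omits.
have ptr (r : nat) : p \mPo comps (trans (along k r%:R)) = p.
  elim: r => [|r IHr].
    rewrite -[RHS]comp_ga1; congr (_ \mPo comps _); apply: ga_ext => i.
    by rewrite transE /along if_same mpolyC0 addr0 ga_oneE.
  have -> : trans (along k r.+1%:R) = (trans (along k r%:R) * trans (along k
    1))%g.
    rewrite transD; apply: eq_trans => i; rewrite /along; case: eqP => _.
      by rewrite -addn1 natrD.
    by rewrite addr0.
  by rewrite comp_gaM IHr.
pose f l := l`!%:R^-1 *: p^`M(k, l) - (if l == 0%N then p else 0).
have : forall r : nat, \sum_(l < (msize p).+2) r.+1%:R ^+ l *: f l = 0.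
  move=> r; rewrite -[RHS](subrr p) -[X in _ = X - _](ptr r.+1) comps_along.
  rewrite (taylor charK k _ (leq_trans (leqnSn _) (leqnSn (msize p).+1))).
  under eq_bigr do rewrite scalerBr; rewrite sumrB; congr (_ - _).
    by apply: eq_bigr => l _; rewrite -[in RHS](rmorphXn (@mpolyC n K)) mulrC
      mul_mpolyC.
  by rewrite big_ord_recl big1 ?addr0 ?expr0 ?scale1r // => l _;
    rewrite scaler0.
have S0 : subspace (fun q => q = 0 :> {mpoly K[n]}).
  by split=> // c p' q -> ->; rewrite scaler0 addr0.
move/(coef_subspace charK S0)/(_ 1%N isT).
by rewrite /f invr1 scale1r mulm1n mderivmU1m subr0.
Qed.

Lemma along_shift_omits k p c :
  p \mPo comps (trans (along k 1)) = p + c%:MP -> omits k (p - c *: 'X_k).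
Proof.
move=> pt; apply: along_invariant_omits.
rewrite comp_mpolyB pt comp_mpolyZ comp_gaX transE /along eqxx mpolyC1.
by rewrite scalerDr opprD addrACA -(mul_mpolyC c 1) mulr1 subrr addr0.
Qed.

Lemma along_commute_omits g k j :
  (g * trans (along k 1) = trans (along k 1) * g)%g -> j != k -> omits k (g j).
Proof.
move=> gt jk; apply: along_invariant_omits.
by rewrite -ga_mulE gt trans_mulE /along (negPf jk) mpolyC0 addr0.
Qed.

Lemma along_commute_omits_sub g k :
  (g * trans (along k 1) = trans (along k 1) * g)%g -> omits k (g k - 'X_k).
Proof.
move=> gt; rewrite -['X_k]scale1r; apply: along_shift_omits.
by rewrite -ga_mulE gt trans_mulE /along eqxx.
Qed.

End Translations.

(** * Automorphisms conjugating a translation *)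

Section Degenerate.
Context {K : fieldType} (charK : [pchar K]%R =i pred0).
Context {n : nat} (n_ge3 : (3 <= n)%N).
Implicit Types (phi psi : GA K n) (k : 'I_n).

(** Here [phi k - 'X_k] and the other components are free of ['X_k]. If one of the other components
    is nonlinear, a conjugated linear shear is the required one; if they are all affine, only
    [phi k] can be nonlinear. *)
Lemma commute_along_cotame phi k :
  (phi * trans (along k 1) = trans (along k 1) * phi)%g ->
  affine_or_cotame phi.
Proof.
set t := trans _ => phit.
have phiVt : (phi^-1 * t = t * phi^-1)%g.
  by apply: (can_inj (mulKg phi)); rewrite mulVKg mulgA phit mulgK.
have oj := along_commute_omits charK phit;
  have ok := along_commute_omits_sub charK phit.
have oVj := along_commute_omits charK phiVt.
have oVk := along_commute_omits_sub charK phiVt.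
clear phit phiVt.
(* Conjugating the linear shear [x_k + x_j] gives the shear [x_k + phi_j]. *)
have Gelem j : j != k -> gen_aff phi (elem k (phi j)).
  move=> jk; have oX : omits k ('X_j : {mpoly K[n]}) by apply: varsX.
  have oP := oj j jk.
  have -> : elem k (phi j) = (phi^-1 * (elem k 'X_j * phi))%g.
    apply: ga_ext => i; rewrite ga_mulE comp_gaM.
    have [->|ik] := eqVneq i k; last first.
      by rewrite (elem_neq oP ik) (comp_elem_id oX (oVj i ik)) -ga_mulE mulVg
        ga_oneE.
    rewrite (elemk oP) -[X in X \mPo comps (elem _ _)](subrK 'X_k).
    rewrite comp_mpolyD (comp_elem_id oX oVk) comp_gaX (elemk oX) addrA subrK.
    by rewrite comp_mpolyD comp_gaX -ga_mulE mulVg ga_oneE.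
  apply: gen_mul; first exact/gen_inv/gen_aff_self.
  apply: gen_mul; last exact: gen_aff_self.
  exact: gen_aff_affine (affine_elem oX (msize2X _)).
case: (boolP [exists j, (j != k) && (2 < msize (phi j))%N]) => [/existsP[j]|].
  case/andP=> jk sj; right.
  exact: (cotame_elem charK n_ge3 (oj j jk) sj (Gelem j jk)).
rewrite negb_exists => /forallP sphi.
have {}sphi j : j != k -> (msize (phi j) <= 2)%N.
  by move=> jk; move: (sphi j); rewrite jk /= -leqNgt.
set P := phi k - 'X_k in ok.
have omP : omits k (- P) by apply: varsN.
have phik : phi k = 'X_k + P by rewrite addrC subrK.
have [sP|sP] := leqP (msize P) 2.
  left; apply/affineP => i; have [->|] := eqVneq i k; last exact: sphi.
  rewrite phik; exact: (subspaceD msize2_subspace (msize2X k) sP).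
right; apply: (cotame_elem charK n_ge3 ok sP).
(* The inverted factor is affine: its components are ['X_k] and the affine [phi i] for [i != k]. *)
have -> : elem k P = ((phi * elem k (- P))^-1 * phi)%g.
  apply: (can_inj (mulKg (phi * elem k (- P))%g)).
  by rewrite mulVKg -mulgA (elemD omP ok) addNr elem0 mulg1.
apply: gen_mul; last exact: gen_aff_self.
apply/gen_inv/gen_aff_affine/affineP => i; rewrite ga_mulE.
have [->|ik] := eqVneq i k.
  rewrite phik comp_mpolyD comp_gaX (elemk omP) (comp_elem_id omP ok) subrK.
  exact: msize2X.
by rewrite (comp_elem_id omP (oj i ik)); apply: sphi.
Qed.

(** Linear changes of coordinates on both sides move [v] and [w] to the same coordinate vector,
    which reduces to a commuting translation. *)
Lemma trans_trans_cotame phi (v w : 'I_n -> K) i0 : v i0 != 0 ->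
  (phi * trans v = trans w * phi)%g -> affine_or_cotame phi.
Proof.
move=> v0 phiv.
(* If [w] were zero, [trans v] would be the identity. *)
have [i1 w0] : exists i1, w i1 != 0.
  apply/existsP; apply: contraNT v0; rewrite negb_exists => /forallP w0.
  have tv : trans v = 1%g.
    apply: (can_inj (mulKg phi)); rewrite phiv mulg1; apply: ga_ext => i.
    by rewrite trans_mulE; move/negPn/eqP: (w0 i) => ->; rewrite mpolyC0 addr0.
  have := congr1 (fun g : GA K n => (g i0)@_0) tv.
  rewrite transE ga_oneE mcoeffD mcoeffC eqxx mulr1 mcoeffX mnm1_eq0 add0r.
  by move=> ->.
pose e : 'rV[K]_n := delta_mx ord0 i0.
have e0 : e != 0.
  by apply/rV0Pn; exists i0; rewrite mxE !eqxx oner_neq0.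
have [|B uB eB] := @unitmx_row _ _ e (\row_i v i) e0.
  by apply/rV0Pn; exists i0; rewrite mxE.
have [|C uC wC] := @unitmx_row _ _ (\row_i w i) e _ e0.
  by apply/rV0Pn; exists i1; rewrite mxE.
pose f := aff C^T (fun=> 0); pose g := aff B^T (fun=> 0).
have uBT : B^T \in unitmx by rewrite unitmx_tr.
have uCT : C^T \in unitmx by rewrite unitmx_tr.
apply: (@affine_or_cotameMl _ _ f); first exact: affine_aff.
apply: (@affine_or_cotameMr _ _ g); first exact: affine_aff.
apply: (@commute_along_cotame _ i0).
have eg : (g * trans (along i0 1) = trans v * g)%g.
  rewrite /g (aff_trans _ _ uBT); congr (_ * _)%g; apply: eq_trans => i.
  move/rowP/(_ i): eB; rewrite !mxE => <-; apply: eq_bigr => j _.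
  by rewrite !mxE eqxx /along mulrC; case: eqP => _; rewrite ?mul1r ?mul0r.
have ef : (f * trans w = trans (along i0 1) * f)%g.
  rewrite /f (aff_trans _ _ uCT); congr (_ * _)%g; apply: eq_trans => i.
  move/rowP/(_ i): wC; rewrite !mxE eqxx /along.
  under eq_bigr do rewrite mxE.
  under [X in _ -> X = _]eq_bigr do rewrite mxE mulrC.
  by move=> ->; rewrite /=; case: eqP.
by rewrite -mulgA eg !mulgA -(mulgA f) phiv mulgA ef.
Qed.

End Degenerate.

(** Since [b] is outside the column space of [N], the rank of [N] is less than that of [row_mx N b],
    which is less than [n] because [l] kills its columns. So [N] has corank at least two, and one
    more equation [l] leaves a nonzero solution. *)
Lemma fixpoint_free_rank (K : fieldType) n (N : 'M[K]_n) (b : 'cV[K]_n)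
    (l : 'rV[K]_n) : (forall c : 'cV[K]_n, N *m c + b != 0) ->
  l != 0 -> l *m N = 0 -> l *m b = 0 ->
  exists u : 'cV[K]_n, [/\ u != 0, N *m u = 0 & l *m u = 0].
Proof.
move=> Nb l0 lN lb.
have ltr : (\rank N < \rank (row_mx N b))%N.
  rewrite -[X in (_ < X)%N]mxrank_tr -[X in (X < _)%N]mxrank_tr tr_row_mx.
  apply: rank_ltmx; rewrite ltmxE; apply/andP; split.
    by apply: submx_trans (addsmxSl N^T b^T) _; rewrite addsmxE.
  rewrite col_mx_sub submx_refl /=; apply/negP => /submxP[D eb].
  have /eqP[] := Nb (- D^T).
  by rewrite mulmxN -[N]trmxK -trmx_mul -eb trmxK addNr.
have rn : (\rank (row_mx N b) < n)%N.
  rewrite ltn_neqAle rank_leq_row andbT; apply: contra l0 => fNb.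
  by apply/eqP; apply: (row_free_inj fNb);
    rewrite mul_mx_row lN lb row_mx0 mul0mx.
have : kermx (row_mx N^T l^T) != 0.
  rewrite kermx_eq0; apply/negP => fNl.
  have := leq_ltn_trans ltr rn.
  rewrite ltnNge => /negP[].
  apply: leq_trans (eq_leq (esym (eqP fNl))) _.
  rewrite -mxrank_tr tr_row_mx !trmxK -addsmxE.
  apply: leq_trans (mxrank_adds_leqif N l) _.
  by rewrite -[X in (_ <= X)%N]addn1 leq_add2l rank_leq_row.
case/rowV0Pn => u /sub_kermxP; rewrite mul_mx_row => /eqP.
rewrite row_mx_eq0 => /andP[/eqP uN /eqP ul] u0.
exists u^T; split; first by rewrite trmx_eq0.
  by rewrite -[N]trmxK -trmx_mul uN trmx0.
by rewrite -[l]trmxK -trmx_mul ul trmx0.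
Qed.

(** * Translations conjugate to an affine map with an invariant linear form *)

Section AffineConjugate.
Context {K : fieldType} (charK : [pchar K]%R =i pred0).
Context {n : nat} (n_ge3 : (3 <= n)%N).
Implicit Types (phi psi : GA K n) (k : 'I_n).

Lemma aff_mul (A B : 'M[K]_n) b c : A \in unitmx -> B \in unitmx ->
  (aff A b * aff B c)%g = aff (A *m B) (fun i => \sum_j A i j * c j + b i).
Proof.
move=> uA uB; apply: ga_ext => i; rewrite ga_mulE !affE ?unitmx_mul ?uA //.
rewrite comp_lin; under eq_bigr do rewrite -/(component _ _) affE // scalerDr.
rewrite big_split /= sum_mxM -addrA mpolyCD raddf_sum /=; congr (_ + (_ + _)).
by apply: eq_bigr => j _; rewrite mpolyCM mul_mpolyC.
Qed.

(** The polynomial [p] grows by 1 under the affine map; evaluation at a fixed point would give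
    [0 = 1]. *)
Lemma no_fixpoint phi k (A : 'M[K]_n) b : A \in unitmx ->
  (phi * trans (along k 1) = aff A b * phi)%g ->
  forall c : 'cV[K]_n, (A - 1%:M) *m c + \col_i b i != 0.
Proof.
move=> uA phit c; apply/eqP => /colP fc.
pose p := (phi^-1)%g k.
have pa : p \mPo comps (aff A b) = p + 1.
  rewrite -ga_mulE; have -> : (phi^-1 * aff A b = trans (along k 1) * phi^-1)%g.
    by apply: (can_inj (mulKg phi)); rewrite mulVKg mulgA phit mulgK.
  by rewrite trans_mulE /along eqxx mpolyC1.
have := congr1 (meval (fun i => c i ord0)) pa.
rewrite comp_mpoly_meval mevalD meval1 (@meval_eq _ _ _ (fun i => c i ord0)).
  by move/eqP; rewrite -subr_eq0 opprD addNKr oppr_eq0 oner_eq0.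
move=> i; rewrite -/(component _ i) affE // mevalD mevalC raddf_sum /=.
have := fc i; rewrite mulmxBl mul1mx !mxE addrAC => /eqP.
rewrite subr_eq0 => /eqP <-; congr (_ + _); apply: eq_bigr => j _.
by rewrite mevalZ mevalXU.
Qed.

(* The maps [x + s u] and [x + s l(x) u] commute with [aff A b]; the Taylor
   coefficients in [s] of their conjugates by [phi] are [q i r] and
   [q i r * y ^+ r] with [y = l(phi)], so that [q i r] is constant for [r > 0].
     *)
Lemma fixed_form_cotame phi k (A : 'M[K]_n) b (l : 'rV[K]_n) : A \in unitmx ->
  (phi * trans (along k 1) = aff A b * phi)%g ->
  l != 0 -> l *m (A - 1%:M) = 0 -> l *m \col_i b i = 0 ->
  affine_or_cotame phi.
Proof.
move=> uA phit l0 lA lb.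
have [u [u0 Au lu]] := fixpoint_free_rank (no_fixpoint uA phit) l0 lA lb.
have {}Au : A *m u = u by move/eqP: Au; rewrite mulmxBl mul1mx subr_eq0 => /eqP.
have {}lA : l *m A = l by move/eqP: lA; rewrite mulmxBr mulmx1 subr_eq0 => /eqP.
set a := aff A b in phit.
pose t : GA K n := trans (along k 1).
(* The conjugate of [e] by [phi] commutes with [t], and its co-tameness passes to [phi]. *)
have conj_or e : (a * e = e * a)%g -> affine e ->
    cotame phi \/ affine (phi^-1 * (e * phi))%g.
  move=> ae Ae; set h := (_ * (_ * _))%g.
  have ht : (h * t = t * h)%g.
    have phiVt : (phi^-1 * a = t * phi^-1)%g.
      by apply: (can_inj (mulKg phi)); rewrite mulVKg mulgA phit mulgK.
    by rewrite /h -!mulgA phit (mulgA e) -ae !mulgA phiVt.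
  case: (commute_along_cotame charK n_ge3 ht) => [|Ch]; [by right | left].
  apply: cotame_gen Ch; apply: gen_mul; first exact/gen_inv/gen_aff_self.
  by apply: gen_mul; [apply: gen_aff_affine | apply: gen_aff_self].
clear phit.
pose L : {mpoly K[n]} := \sum_j l ord0 j *: 'X_j.
pose y := L \mPo comps phi.
have yE : y = \sum_j l ord0 j *: phi j.
  rewrite /y /L raddf_sum /=; apply: eq_bigr => j _.
  by rewrite comp_mpolyZ comp_gaX.
pose uf i := u i ord0.
pose Z i := sval (taylor_along uf ((phi^-1)%g i)).
have ZE i Y : (phi^-1)%g i \mPo shift_along uf Y = (Z i).[Y].
  exact: (svalP (taylor_along uf _)).
pose q i r := (Z i)`_r \mPo comps phi.
(* The alternative [cotame phi] is carried inside the predicate, which remains a subspace, so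
   coefficients can be extracted without deciding co-tameness. *)
pose S (p : {mpoly K[n]}) := cotame phi \/ (msize p <= 2)%N.
have SS : subspace S.
  split=> [|c p p' [Cp|sp] [Cp'|sp']]; try by left.
    by right; rewrite msize0.
  by right; apply: (msize2_subspace.2).
have comp_q i Y : (Z i).[Y] \mPo comps phi =
    \sum_(r < size (Z i)) q i r * (Y \mPo comps phi) ^+ r.
  rewrite horner_coef raddf_sum /=; apply: eq_bigr => r _.
  by rewrite rmorphM rmorphXn.
have conj_e (e : GA K n) Y i : comps e = shift_along uf Y ->
    (phi^-1 * (e * phi))%g i =
    \sum_(r < size (Z i)) q i r * (Y \mPo comps phi) ^+ r.
  by move=> eE; rewrite mulgA !ga_mulE eE ZE comp_q.
have affS (e : GA K n) i : (a * e = e * a)%g -> affine e ->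
    S ((phi^-1 * (e * phi))%g i).
  by move=> ae Ae; case: (conj_or e ae Ae) => [|Ah]; [left | right; rewrite Ah].
have Sq i r : (r < size (Z i))%N -> S (q i r).
  apply: (coef_subspace charK SS) => s.
  pose e := trans (fun j => s.+1%:R * uf j).
  have ae : (a * e = e * a)%g.
    rewrite /a (aff_trans _ _ uA); congr (_ * _)%g; apply: eq_trans => j.
    move/colP/(_ j): Au; rewrite mxE /uf => <-; rewrite mulr_sumr.
    by apply: eq_bigr => m _; rewrite mulrCA.
  have := affS e i ae (affine_trans _).
  rewrite (@conj_e _ s.+1%:R%:MP); last first.
    apply: eq_from_tnth => j; rewrite tnth_mktuple -/(component e j) transE.
    by rewrite mulrC mpolyCM mul_mpolyC.
  congr S; apply: eq_bigr => j _.
  by rewrite comp_mpolyC -(rmorphXn (@mpolyC n K)) mulrC mul_mpolyC.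
have Sqy i r : (r < size (Z i))%N -> S (q i r * y ^+ r).
  move=> rZ; apply: (coef_subspace charK SS (f := fun r => q i r * y ^+ r)) rZ
    => s.
  (* A transvection: it is invertible because [l *m u = 0], and it commutes with [a] because [A]
     fixes [u] and [l] while [l] kills [b]. *)
  pose B := 1%:M + s.+1%:R *: (u *m l).
  have uul : (u *m l) *m (u *m l) = 0.
    by rewrite mulmxA -(mulmxA u) lu mulmx0 mul0mx.
  have uB : B \in unitmx.
    have [] // := @mulmx1_unit _ _ B (1%:M - s.+1%:R *: (u *m l)).
    rewrite mulmxBr mulmx1 mulmxDl mul1mx -scalemxAr -scalemxAl uul.
    by rewrite !scaler0 addr0 addrK.
  pose e := aff B (fun=> 0).
  have ae : (a * e = e * a)%g.
    rewrite /a /e (aff_mul _ _ uA uB) (aff_mul _ _ uB uA).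
    have -> : A *m B = B *m A.
      rewrite /B mulmxDr mulmxDl mulmx1 mul1mx -scalemxAr -scalemxAl.
      by rewrite mulmxA Au -mulmxA lA.
    apply: ga_ext => j; rewrite !affE ?unitmx_mul ?uB //; congr (_ + _%:MP).
    rewrite addr0 big1 ?add0r => [|m _]; last by rewrite mulr0.
    have : B *m \col_i b i = \col_i b i.
      by rewrite mulmxDl mul1mx -scalemxAl -mulmxA lb mulmx0 scaler0 addr0.
    move/colP/(_ j); rewrite !mxE => <-.
    by apply: eq_bigr => m _; rewrite [in LHS](mxE _ _ m).
  have := affS e i ae (affine_aff _ uB).
  rewrite (@conj_e _ (s.+1%:R *: L)); last first.
    apply: eq_from_tnth => j; rewrite tnth_mktuple -/(component e j) affE //.
    rewrite mpolyC0 addr0 -[X in X + _](sum_mx1 (fun m => 'X_m : {mpoly K[n]}))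
      scalerA /L scaler_sumr -big_split.
    apply: eq_bigr => m _ /=; rewrite scalerA -scalerDl; congr (_ *: _).
    by rewrite /B mxE; congr (_ + _); rewrite mxE mxE big_ord1 mulrCA mulrA.
  congr S; apply: eq_bigr => j _.
  by rewrite comp_mpolyZ -/y exprZn scalerAr.
have sy : (1 < msize y)%N.
  rewrite ltnNge; apply: contra l0 => /mpoly_const ey; apply/eqP/rowP => j.
  by rewrite mxE; apply: (@comps_free _ _ phi _ (y@_0)); rewrite -yE.
have y0 : y != 0 by apply: contraTneq sy => ->; rewrite msize0.
have qconst i r : (0 < r < size (Z i))%N -> cotame phi \/ (msize (q i r) <=
  1)%N.
  case/andP; case: r => // r _ rZ.
  have [|sqy] := Sqy i r.+1 rZ; [by left | right].
  have [->|q0] := eqVneq (q i r.+1) 0; first by rewrite msize0.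
  move: sqy; rewrite exprS mulrA msizeM ?mulf_neq0 ?expf_neq0 // msizeM //.
  have : (0 < msize (y ^+ r))%N by rewrite lt0n msize_poly_eq0 expf_neq0.
  move: sy; case: (msize y) => [|[|sy]] // _; case: (msize (y ^+ r)) => // sr _.
  rewrite !addnS /= addSn ltnS => sqr.
  by rewrite (leq_trans _ sqr) // -addnA leq_addr.
(* Sizes are decidable over this finite range, so either one index yields co-tameness or all the
   coefficients of positive order are constant. *)
pose bad := [exists i, exists r : 'I_(size (Z i)), (0 < r)%N && (1 < msize (q i
  r))%N].
case: (boolP bad) => [/existsP[i /existsP[r /andP[r0 sq]]]|nbad].
  by right; case: (qconst i r); rewrite ?r0 ?ltn_ord // leqNgt sq.
have {nbad} sq i r : (0 < r < size (Z i))%N -> (msize (q i r) <= 1)%N.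
  case/andP=> r0 rZ; rewrite leqNgt; apply: contra nbad => sq.
  by apply/existsP; exists i; apply/existsP; exists (Ordinal rZ); rewrite r0.
pose e := trans uf.
have [j0 uj0] : exists j, uf j != 0.
  by case/cV0Pn: u0 => j; exists j.
(* Evaluation at [Y = 0] identifies the zeroth coefficient with ['X_i], so the constants of positive
   order make up a translation vector. *)
pose w i := \sum_(r < size (Z i) | (0 < r)%N) (q i r)@_0.
have he : (phi^-1 * (e * phi))%g = trans w.
  apply: ga_ext => i; rewrite (@conj_e _ 1); last first.
    by apply: eq_from_tnth => j; rewrite tnth_mktuple -/(component e j) transE
      alg_mpolyC.
  rewrite comp_mpoly1 transE.
  under eq_bigr do rewrite expr1n mulr1.
  rewrite (bigID (fun r : 'I__ => (0 < r)%N)) /= addrC; congr (_ + _).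
    have -> : 'X_i = (Z i).[0] \mPo comps phi.
      rewrite -ZE; have -> : shift_along uf 0 = comps (1%g : GA K n).
        apply: eq_from_tnth => j; rewrite tnth_mktuple scaler0 addr0.
        by rewrite -/(component _ j) ga_oneE.
      by rewrite comp_ga1 -comp_gaX comp_gaVK.
    rewrite comp_q comp_mpoly0 [RHS](bigID (fun r : 'I__ => (0 < r)%N)) /=.
    rewrite [X in _ = X + _]big1 ?add0r => [|r r0]; last first.
      by rewrite expr0n gtn_eqF // mulr0.
    apply: eq_bigr => r; rewrite -leqNgt leqn0 => /eqP ->.
    by rewrite expr0 mulr1.
  rewrite raddf_sum /=; apply: eq_bigr => r r0; apply: mpoly_const.
  by apply: sq; rewrite r0 ltn_ord.
apply: affine_or_cotameV; apply: (@trans_trans_cotame _ charK _ n_ge3 _ uf w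
  j0) => //.
by rewrite -he -!mulgA mulgV mulg1.
Qed.

End AffineConjugate.

(** A constructive exchange of a disjunction with a finite quantifier, needed because [C] will be
    co-tameness. *)
Lemma fin_or_all (T : finType) (C : Prop) (P : T -> Prop) :
  (forall x, C \/ P x) -> C \/ forall x, P x.
Proof.
move=> CP; suff [|H] : C \/ forall x, x \in enum T -> P x; [by left | |].
  by right=> x; apply: H; rewrite mem_enum.
elim: (enum T) => [|x s [|IH]]; [by right | by left |].
case: (CP x) => [|Px]; [by left | right=> y].
by rewrite inE => /predU1P[->|/IH].
Qed.

(** * Weighted homogeneous decomposition *)

Section Weights.
Context {K : fieldType} {n : nat}.
Implicit Types (p q : {mpoly K[n]}) (m : 'X_{1..n}) (i j : 'I_n).

(** The weighted degree in which ['X_i] has weight [i.+1], since indices start at 0. *)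
Definition weight m := (\sum_i m i * i.+1)%N.

Definition wpart d p := \sum_(m <- msupp p | weight m == d) p@_m *: 'X_[m].

Lemma mcoeff_wpart d p m : (wpart d p)@_m = if weight m == d then p@_m else 0.
Proof.
rewrite /wpart raddf_sum /=; under eq_bigr do rewrite mcoeffZ mcoeffX.
case: (boolP (m \in msupp p)) => [mp|mp].
  case: (eqVneq (weight m) d) => [md|md].
    rewrite (big_rem m) //= md eqxx eqxx mulr1 big_seq_cond big1 ?addr0 // =>
      m'.
    rewrite mem_rem_uniq ?msupp_uniq // inE => /andP[/andP[/negPf -> _] _].
    by rewrite mulr0.
  rewrite big1 // => m' /eqP m'd; case: eqP => [em|_]; last by rewrite mulr0.
  by rewrite -em m'd eqxx in md.
rewrite big_seq_cond big1 => [|m' /andP[m'p _]].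
  by rewrite (memN_msupp_eq0 mp) if_same.
by case: eqP => [em|_]; [rewrite -em m'p in mp | rewrite mulr0].
Qed.

Lemma comp_wscale (s : K) p D : {in msupp p, forall m, weight m < D}%N ->
  p \mPo [tuple s ^+ i.+1 *: 'X_i | i < n] = \sum_(d < D) s ^+ d *: wpart d p.
Proof.
move=> pD; rewrite comp_mpolyEX.
transitivity (\sum_(m <- msupp p) s ^+ weight m *: (p@_m *: 'X_[m])).
  apply: eq_bigr => m _; rewrite comp_mpolyX scalerA mulrC -scalerA.
  congr (_ *: _); rewrite mpolyXE_id /weight.
  under [LHS]eq_bigr do rewrite tnth_mktuple exprZn -exprM mulnC.
  by rewrite scaler_prod prodrXr.
rewrite /wpart; under [RHS]eq_bigr do rewrite scaler_sumr.
rewrite (exchange_big_dep predT) //= big_seq_cond [RHS]big_seq_cond.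
apply: eq_bigr => m /andP[mp _].
by rewrite (big_pred1 (Ordinal (pD m mp))) // => d; rewrite /= eq_sym -val_eqE.
Qed.

Lemma weightU i : weight U_(i) = i.+1.
Proof.
rewrite /weight (bigD1 i) //= mnm1E eqxx mul1n big1 ?addn0 // => j ji.
by rewrite mnm1E eq_sym (negPf ji).
Qed.

Lemma weight_ge m j : (m j * j.+1 <= weight m)%N.
Proof. by rewrite /weight (bigD1 j) //= leq_addr. Qed.

(** A factor ['X_j] with [i <= j] already uses up the whole weight, which forces the monomial to be
    ['X_i] itself. *)
Lemma weight_low m i j : weight m = i.+1 -> m != U_(i)%MM -> (i <= j)%N -> m j
  = 0%N.
Proof.
move=> wm mU ij; apply/eqP; rewrite -[_ == _]negbK -lt0n; apply/negP => mj.
have [m' em] : exists m', m = (m' + U_(j))%MM.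
  by exists (m - U_(j))%MM; rewrite submK // lep1mP -lt0n.
have wD m1 m2 : weight (m1 + m2)%MM = (weight m1 + weight m2)%N.
  by rewrite /weight -big_split; apply: eq_bigr => l _; rewrite mnmDE mulnDl.
move: wm mU; rewrite em wD weightU => e.
have ji : j = i.
  by apply: val_inj; apply/eqP; rewrite eqn_leq ij andbT -ltnS -e leq_addl.
move/eqP: e; rewrite ji -[X in _ == X]add0n eqn_add2r => /eqP w0.
suff -> : m' = 0%MM by rewrite add0m eqxx.
apply/mnmP => l; rewrite mnm0E; apply/eqP.
by have := weight_ge m' l; rewrite w0 leqn0 muln_eq0 orbF.
Qed.

End Weights.

(** * Automorphisms whose components form a chain under differentiation *)

Section Chain.
Context {K : fieldType} (charK : [pchar K]%R =i pred0).
Context {n : nat} (n_ge3 : (3 <= n)%N).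
Implicit Types (phi psi g : GA K n) (k : 'I_n).

(** The coefficient of ['X_i] is the value at 0 of the derivative, so by the Leibniz rule its
    vanishing is stable under products. *)
Lemma comp_mcoeffU0 i (p : {mpoly K[n]}) (t : n.-tuple {mpoly K[n]}) :
  (forall j, (tnth t j)@_U_(i) = 0) -> (p \mPo t)@_U_(i) = 0.
Proof.
move=> t0; pose Z (q : {mpoly K[n]}) := q@_U_(i) = 0.
have ZE (q : {mpoly K[n]}) : q@_U_(i) = q^`M(i)@_0.
  by rewrite mcoeff_mderiv add0m mnm0E.
have ZM q1 q2 : Z q1 -> Z q2 -> Z (q1 * q2).
  rewrite /Z !ZE mderivM mcoeffD !rmorphM /= => -> ->.
  by rewrite mul0r mulr0 addr0.
have Z1 : Z 1 by rewrite /Z mcoeff1 mnm1_eq0.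
rewrite comp_mpolyEX raddf_sum big1 //= => m _.
rewrite mcoeffZ comp_mpolyX; apply/eqP; rewrite mulf_eq0; apply/orP; right.
apply/eqP; apply: (big_ind Z) => // j _; elim: (m j) => [|e IH] //.
by rewrite exprS; apply: ZM => //; apply: t0.
Qed.

Definition span1 (phi : GA K n) p :=
  exists (l : 'I_n -> K) c, p = \sum_i l i *: phi i + c%:MP.

Lemma span1_subspace phi : subspace (span1 phi).
Proof.
split=> [|c p q [l [e ->]] [l' [e' ->]]].
  exists (fun=> 0), 0; rewrite mpolyC0 addr0 big1 // => i _.
  by rewrite scale0r.
exists (fun i => c * l i + l' i), (c * e + e').
rewrite scalerDr mpolyCD mpolyCM mul_mpolyC addrACA; congr (_ + _).
rewrite scaler_sumr -big_split; apply: eq_bigr => i _ /=.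
by rewrite scalerDl scalerA.
Qed.

Lemma span1_affine_mul phi a i : affine a -> span1 phi ((a * phi)%g i).
Proof.
move=> aa; exists (fun j => (a i)@_U_(j)), (a i)@_0.
by rewrite ga_mulE [in LHS](mpoly_lin (affine_msize2 i aa)) comp_lin.
Qed.

Lemma span1C phi c : span1 phi c%:MP.
Proof.
exists (fun=> 0), c; rewrite big1 ?add0r // => i _.
by rewrite scale0r.
Qed.

Variables (psi : GA K n) (k : 'I_n) (f : nat -> {mpoly K[n]}).
Hypotheses (f0 : f 0 = 1) (df : forall j, (j < n)%N -> (f j.+1)^`M(k) = f j).
Hypothesis psiE : forall i : 'I_n, psi i = f i.+1.

Lemma chain_mderiv l j : (j <= n)%N ->
  (f j)^`M(k, l) = if (l <= j)%N then f (j - l) else 0.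
Proof.
elim: l j => [|l IHl] j jn; first by rewrite mulm0n mderivm0m subn0.
rewrite mulmS mderivmDm mderivmU1m; case: j jn => [|j] jn.
  by rewrite f0 mderivC raddf0.
by rewrite df // IHl // ltnW.
Qed.

Let wscale (s : K) : GA K n := diag_ga (fun i => s ^+ i.+1).

(* By Taylor's formula, [psi] turns the translations along [x_k] into a
   one-parameter group that is normalised by the weighted torus. *)
Lemma chain_wscale_commute (s : K) : s != 0 ->
  ((psi^-1 * (wscale s * psi)) * trans (along k 1)
   = trans (along k s) * (psi^-1 * (wscale s * psi)))%g.
Proof.
move=> s0; set g := (_ * (_ * _))%g.
have sd0 (i : 'I_n) : s ^+ i.+1 != 0 by rewrite expf_neq0.
have psig : (psi * g = wscale s * psi)%g by rewrite /g mulVKg.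
have fg j : (j <= n)%N -> f j \mPo comps g = s ^+ j *: f j.
  case: j => [|j] jn; first by rewrite f0 comp_mpoly1 scale1r.
  rewrite -(psiE (Ordinal jn)) -ga_mulE psig ga_mulE (diag_gaE _ sd0).
  by rewrite comp_mpolyZ comp_gaX.
(* After composition with [psi], component [i] of both sides is [s ^+ i.+1] times the sum of
   [f (i.+1 - l) / l!] over [l <= i.+1]. *)
apply: (can_inj (mulKg psi)); rewrite [LHS]mulgA [RHS]mulgA psig.
clear psig; apply: ga_ext => i.
rewrite !ga_mulE (diag_gaE _ sd0) comp_mpolyZ comp_gaX.
rewrite comp_mpolyZ !comps_along !(taylor charK k _ (leqnn _)) psiE.
rewrite scaler_sumr [RHS]raddf_sum /=; apply: eq_bigr => l _.
rewrite mpolyC1 expr1n mulr1 rmorphM rmorphXn /= comp_mpolyC comp_mpolyZ.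
rewrite chain_mderiv //; case: ifP => li; last by rewrite comp_mpoly0 !scaler0
  mul0r.
rewrite fg ?(leq_trans (leq_subr _ _)) // -(rmorphXn (@mpolyC n K)) mulrC.
rewrite mul_mpolyC !scalerA mulrC; congr (_ *: _).
by rewrite mulrAC -exprD subnKC // mulrC.
Qed.

(** Unless a conjugate of the torus by [psi] is co-tame, the span of 1 and the components of
    [psi^-1] is stable under the torus, hence contains all weight components. These supply a basis
    that is unipotent triangular. *)
Lemma chain_cotame : affine_or_cotame psi.
Proof.
pose I := (psi^-1)%g.
pose S p := cotame psi \/ span1 I p.
have SF := span1_subspace I.
have SS : subspace S.
  split=> [|c p q [Cp|Fp] [Cq|Fq]]; try by left.
    by right; case: SF.
  by right; apply: SF.2.
have SI (i : 'I_n) d : S (wpart d (I i)).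
  pose D := (\max_(m <- msupp (I i)) weight m + d).+1.
  have lD : {in msupp (I i), forall m, weight m < D}%N.
    move=> m mI; rewrite ltnS (leq_trans _ (leq_addr _ _)) //.
    exact: leq_bigmax_seq.
  have dD : (d < D)%N by rewrite ltnS leq_addl.
  apply: (coef_subspace charK SS (f := fun d => wpart d (I i))) dD => r.
  have r0 : r.+1%:R != 0 :> K by apply: natrS_neq0.
  have rd0 (j : 'I_n) : r.+1%:R ^+ j.+1 != 0 :> K by rewrite expf_neq0.
  rewrite -comp_wscale //; set g := (psi^-1 * (wscale r.+1%:R * psi))%g.
  have -> : [tuple r.+1%:R ^+ j.+1 *: 'X_j | j < n] = comps (wscale r.+1%:R).
    apply: eq_from_tnth => j; rewrite tnth_mktuple -/(component _ j).
    by rewrite diag_gaE.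
  have k1 : along k 1 k != 0 :> K by rewrite /along eqxx oner_neq0.
  case: (trans_trans_cotame charK n_ge3 k1 (chain_wscale_commute r0)) =>
    [ag|Cg].
    right; rewrite -ga_mulE.
    have -> : (I * wscale r.+1%:R = g * I)%g by rewrite /g -!mulgA mulgV mulg1.
    exact: span1_affine_mul.
  left; apply: cotame_gen Cg; apply: gen_mul; first exact/gen_inv/gen_aff_self.
  apply: gen_mul; last exact: gen_aff_self.
  exact/gen_aff_affine/affine_diag.
(* A polynomial of weight [i + 1] is the sum of a multiple of ['X_i] and of a
   polynomial in the variables of smaller index. *)
have SE (i : 'I_n) : cotame psi \/ exists p, span1 I p /\
    [/\ p@_U_(i) = 1, forall j, j != i -> p@_U_(j) = 0 &
       vars (fun j : 'I_n => (j < i)%N) (p - 'X_i)].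
  (* Otherwise ['X_i], obtained by substituting [psi^-1] into [psi i], would have no linear term in
     ['X_i]. *)
  have [j Ij] : exists j, (I j)@_U_(i) != 0.
    apply/existsP; apply: contraT; rewrite negb_exists => /forallP I0.
    have := comp_gaK psi 'X_i => /(congr1 (mcoeff U_(i))).
    rewrite mcoeffXU eqxx comp_mcoeffU0 => [/eqP|l].
      by rewrite eq_sym oner_eq0.
    by apply/eqP; rewrite -[_ == _]negbK; apply: I0.
  pose p := ((I j)@_U_(i))^-1 *: wpart i.+1 (I j).
  have pE m : p@_m = if weight m == i.+1 then ((I j)@_U_(i))^-1 * (I j)@_m else
    0.
    by rewrite mcoeffZ mcoeff_wpart; case: ifP; rewrite ?mulr0.
  have [|Fp] := subspaceZ ((I j)@_U_(i))^-1 SS (SI j i.+1); first by left.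
  right; exists p; split=> //; split.
  - by rewrite pE weightU eqxx mulVf.
  - by move=> l li; rewrite pE weightU eqSS val_eqE (negPf li).
  move=> m l; rewrite mcoeff_msupp mcoeffB pE mcoeffX -leqNgt.
  have [<-|mU] := eqVneq U_(i)%MM m; first by rewrite weightU eqxx mulVf //
    subrr eqxx.
  rewrite subr0; case: (eqVneq (weight m) i.+1) => [wm _|];
    last by rewrite eqxx.
  by apply: weight_low => //; rewrite eq_sym.
case: (fin_or_all SE) => [|/fin_all_exists[e eP]]; [by right |].
have [M [c ME]] : exists (M : 'I_n -> 'I_n -> K) c, forall i,
    e i = \sum_j M i j *: I j + (c i)%:MP.
  have /fin_all_exists[M /fin_all_exists[c ME]] : forall i, exists l, exists c0,
      e i = \sum_j l j *: I j + c0%:MP.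
    by move=> i; case: (eP i).
  by exists M, c.
pose A : 'M[K]_n := \matrix_(i, j) M i j.
have uA : A \in unitmx.
  apply: (@indep_unitmx _ _ e I A c) => [i|l b le j].
    by rewrite ME; congr (_ + _); apply: eq_bigr => j _; rewrite mxE.
  move/(congr1 (mcoeff U_(j))): le; rewrite mcoeffC mnm1_eq0 mulr0 raddf_sum /=.
  rewrite (bigD1 j) //= mcoeffZ; case: (eP j) => _ [-> _ _]; rewrite mulr1.
  rewrite big1 ?addr0 // => m mj; rewrite mcoeffZ.
  by case: (eP m) => _ [_ -> //]; rewrite ?mulr0 // eq_sym.
pose rho := (aff A c * I)%g.
have rhoE i : rho i = e i.
  rewrite ga_mulE affE // comp_lin ME; congr (_ + _).
  by apply: eq_bigr => j _; rewrite mxE.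
apply: affine_or_cotameV; apply: (@affine_or_cotameMl _ _ (aff A c)).
  exact: affine_aff.
(* No [rho i - 'X_i] involves the last variable, so [rho] commutes with the translation along it. *)
have n0 : (n.-1 < n)%N by case: (n) n_ge3.
pose z := Ordinal n0.
apply: (commute_along_cotame charK n_ge3 (k := z)); apply: ga_ext => i.
rewrite trans_mulE ga_mulE rhoE; case: (eP i) => _ [_ _ vi].
rewrite -{1}[e i](subrK 'X_i) comp_mpolyD comp_gaX transE omits_along.
  by rewrite addrA subrK.
apply: sub_vars vi => j /= ji; apply: contraTneq ji => ->.
by rewrite -leqNgt -ltnS /= prednK ?ltn_ord // (leq_trans _ n_ge3).
Qed.

End Chain.

(** * The single Jordan block, and the case distinction for affine conjugates *)

Section AffineConj.
Context {K : fieldType} (charK : [pchar K]%R =i pred0).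
Context {n : nat} (n_ge3 : (3 <= n)%N).
Implicit Types (phi psi a : GA K n) (k : 'I_n) (p : {mpoly K[n]}).

Lemma mderivn_const k l (c : K) : (0 < l)%N -> (c%:MP : {mpoly K[n]})^`M(k, l)
  = 0.
Proof.
by case: l => // l _; rewrite mulmS mderivmDm mderivmU1m mderivC raddf0.
Qed.

Lemma mderivn_eq0 k p l : (msize p <= l)%N -> p^`M(k, l) = 0.
Proof.
elim: l p => [|l IHl] p sp.
  by move: sp; rewrite leqn0 msize_poly_eq0 mulm0n mderivm0m => /eqP.
rewrite mulmS mderivmDm mderivmU1m IHl //.
have [->|p0] := eqVneq p 0; first by rewrite mderiv0 msize0.
by rewrite -ltnS (leq_trans (msize_mderiv k p0)).
Qed.

Lemma mderivnD k l1 l2 p : p^`M(k, l1 + l2) = (p^`M(k, l1))^`M(k, l2).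
Proof. by rewrite -mderivmDm; congr mderivm; apply/mnmP => i;
  rewrite mnmDE !mulmnE mulnDr. Qed.

Section OneBlock.
Variables (phi a : GA K n) (k : 'I_n).
Hypotheses (aff_a : affine a) (phit : (phi * trans (along k 1) = a * phi)%g).

Let F := span1 phi.
Let FS := span1_subspace phi.

Lemma span1_trans p (r : nat) : F p -> F (p \mPo comps (trans (along k r%:R))).
Proof.
elim: r p => [|r IHr] p Fp.
  have -> : trans (along k 0%:R) = 1%g :> GA K n.
    by apply: ga_ext => i; rewrite transE /along if_same mpolyC0 addr0 ga_oneE.
  by rewrite comp_ga1.
have -> : trans (along k r.+1%:R) = (trans (along k 1) * trans (along k
  r%:R))%g :> GA K n.
  rewrite transD; apply: eq_trans => i; rewrite /along; case: eqP => _.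
    by rewrite -add1n natrD.
  by rewrite addr0.
rewrite comp_gaM; apply: IHr; case: Fp => l [c ->].
rewrite comp_mpolyD comp_mpolyC raddf_sum /=.
apply: (subspaceD FS); last exact: span1C.
apply: (subspace_sum _ FS) => i _; rewrite comp_mpolyZ; apply: (subspaceZ _ FS).
by rewrite -ga_mulE phit; apply: span1_affine_mul.
Qed.

(** The span is stable under the integral translations along ['X_k], hence under their linear Taylor
    coefficient. *)
Lemma span1_mderiv p : F p -> F p^`M(k).
Proof.
move=> Fp; pose f l := l`!%:R^-1 *: p^`M(k, l).
have : forall r : nat, F (\sum_(l < (msize p).+2) r.+1%:R ^+ l *: f l).
  move=> r; have := span1_trans r.+1 Fp; rewrite comps_along.
  rewrite (taylor charK k _ (leq_trans (leqnSn _) (leqnSn (msize p).+1))).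
  congr F; apply: eq_bigr => l _.
  by rewrite -(rmorphXn (@mpolyC n K)) mulrC mul_mpolyC.
move/(coef_subspace charK FS)/(_ 1%N isT).
by rewrite /f invr1 scale1r mulm1n mderivmU1m.
Qed.

End OneBlock.

(** The derivative is nilpotent on the span with kernel the constants, so it acts as one Jordan
    block, and a Jordan basis brings [phi] to the form of a chain. *)
Lemma one_block_cotame phi k (F := span1 phi) :
  (forall p, F p -> F p^`M(k)) ->
  (forall p, F p -> p^`M(k) = 0 -> p = (p@_0)%:MP) ->
  affine_or_cotame phi.
Proof.
move=> span1_mderiv invariants_const; have FS := span1_subspace phi.
have span1_mderivn p l : F p -> F (p^`M(k, l)).
  elim: l p => [|l IHl] p Fp; first by rewrite mulm0n mderivm0m.
  by rewrite mulmS mderivmDm mderivmU1m; apply/IHl/span1_mderiv.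
have exD : exists d, [forall i, (phi i)^`M(k, d) == 0].
  exists (\max_i msize (phi i)); apply/forallP => i; apply/eqP/mderivn_eq0.
  exact: leq_bigmax.
case: (ex_minnP exD) => d0 /forallP dphi dmin.
case: d0 dphi dmin => [|d] dphi dmin.
  have := dphi k; rewrite mulm0n mderivm0m => /eqP phik0.
  by case: (@comp_neq_const _ _ phi k 0); rewrite mpolyC0.
have dF p : F p -> p^`M(k, d.+1) = 0.
  case=> l [c ->]; rewrite raddfD /= mderivn_const // addr0 raddf_sum big1 //=
    => i _.
  by rewrite mderivmZ (eqP (dphi i)) scaler0.
have [i0 phi0] : exists i0, (phi i0)^`M(k, d) != 0.
  apply/existsP; apply: contraT; rewrite negb_exists => /forallP phi0.
  suff /dmin : [forall i, (phi i)^`M(k, d) == 0] by rewrite ltnn.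
  by apply/forallP => i; rewrite -[_ == _]negbK.
have Fphi i : F (phi i).
  by rewrite -[phi]mul1g; apply: span1_affine_mul; apply: affine1.
(* A generator of the block: [d.+1] is the nilpotency index, and the last nonzero derivative is a
   constant that is scaled to 1. *)
have [f Ff fd] : exists2 f, F f & f^`M(k, d) = 1.
  pose c := ((phi i0)^`M(k, d))@_0.
  have ec : (phi i0)^`M(k, d) = c%:MP.
    apply: invariants_const; first exact: span1_mderivn.
    by rewrite -mderivmU1m -[U_(k)%MM]mulm1n -mderivnD addn1 (eqP (dphi _)).
  have c0 : c != 0 by apply: contraNneq phi0; rewrite ec => ->; rewrite mpolyC0.
  exists (c^-1 *: phi i0); first exact: (subspaceZ _ FS (Fphi i0)).
  by rewrite mderivmZ ec -mul_mpolyC -mpolyCM mulVf.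
pose g j := f^`M(k, d - j).
have Fg j : F (g j) by apply: span1_mderivn.
have dg l j : (j <= d)%N -> (g j)^`M(k, l) = if (l <= j)%N then g (j - l)%N
  else 0.
  move=> jd; rewrite -mderivnD; case: leqP => lj.
    by rewrite /g subnBA // addnBAC.
  have -> : (d - j + l = d + (l - j))%N by rewrite addnBA ?(ltnW lj) // addnBAC.
  by rewrite mderivnD fd -mpolyC1 mderivn_const // subn_gt0.
have g0 : g 0%N = 1 by rewrite /g subn0.
have span_g p j : (j <= d.+1)%N -> F p -> p^`M(k, j) = 0 ->
    exists c : nat -> K, p = \sum_(i < j) c i *: g i.
  elim: j p => [|j IHj] p jd Fp dp.
    exists (fun=> 0); rewrite big_ord0.
    by move: dp; rewrite mulm0n mderivm0m.
  pose e := (p^`M(k, j))@_0.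
  have ep : p^`M(k, j) = e%:MP.
    apply: invariants_const; first exact: span1_mderivn.
    by rewrite -mderivmU1m -[U_(k)%MM]mulm1n -mderivnD addn1.
  case: (IHj (p - e *: g j)) => [|||c pE].
  - exact: ltnW.
  - apply: (subspaceB FS) => //; exact: (subspaceZ _ FS (Fg j)).
  - rewrite raddfB /= mderivmZ dg // leqnn subnn g0 ep.
    by rewrite -mul_mpolyC mulr1 subrr.
  exists (fun i => if i == j then e else c i).
  rewrite big_ord_recr /= eqxx -[LHS](subrK (e *: g j)) pE; congr (_ + _).
  by apply: eq_bigr => i _; rewrite ltn_eqF.
(* Otherwise the [n] components lie, modulo constants, in the span of [g 1], ..., [g d] with
   [d < n], against their independence. *)
have nd : (n <= d)%N.
  rewrite leqNgt; apply/negP => dn.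
  have /fin_all_exists[c phiE] : forall i : 'I_n, exists c : nat -> K,
      phi i = \sum_(j < d.+1) c j *: g j.
    by move=> i; apply: span_g => //; apply: dF.
  pose C : 'M[K]_(n, d) := \matrix_(i, j) c i j.+1.
  have : kermx C != 0.
    rewrite kermx_eq0; apply: contraTneq dn => <-.
    by rewrite -leqNgt rank_leq_col.
  case/rowV0Pn => l /sub_kermxP lC /negP[]; apply/eqP/rowP => j; rewrite mxE.
  apply: (@comps_free _ _ phi _ (\sum_i l ord0 i * c i 0%N)).
  under eq_bigr do rewrite phiE big_ord_recl scalerDr /= g0.
  rewrite big_split /= -[RHS]addr0; congr (_ + _).
    rewrite raddf_sum /=; apply: eq_bigr => i _.
    by rewrite -!mul_mpolyC mulr1 mpolyCM.
  under eq_bigr do rewrite scaler_sumr.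
  rewrite exchange_big big1 //= => m _.
  under eq_bigr do rewrite scalerA.
  rewrite -scaler_suml; suff -> : \sum_i l ord0 i * c i m.+1 = 0 by rewrite
    scale0r.
  move/matrixP/(_ ord0 m): lC; rewrite [LHS]mxE [RHS]mxE => lCm.
  by rewrite -[RHS]lCm; apply: eq_bigr => i _; rewrite mxE.
have g_indep (l : 'I_n -> K) c : \sum_(i < n) l i *: g i.+1 = c%:MP -> forall
  i, l i = 0.
  (* Descending induction on the index: the derivative of order [i.+1] kills the terms below [i],
     and those above have coefficient zero already. *)
  move=> lg i; have [e] := ubnP (n - i); elim: e i => // e IHe i;
    rewrite ltnS => ie.
  have := congr1 (mderivm (U_(k) *+ i.+1)) lg.
  rewrite mderivn_const // raddf_sum /= (bigD1 i) //= mderivmZ dg ?(leq_trans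
    (ltn_ord i) nd) // leqnn.
  rewrite subSS subnn g0 big1 ?addr0 => [|m mi].
    by move/(congr1 (mcoeff 0%MM)); rewrite mcoeffZ mcoeff1 eqxx mulr1 mcoeff0.
  rewrite mderivmZ dg ?(leq_trans (ltn_ord m) nd) // ltnS; case: leqP => im;
    last by rewrite scaler0.
  rewrite IHe ?scale0r // (leq_trans _ ie) // ltn_sub2l // ltn_neqAle im andbT.
  by rewrite eq_sym val_eqE.
have /fin_all_exists[M /fin_all_exists[c gE]] : forall i : 'I_n, exists l,
  exists c,
    g i.+1 = \sum_j l j *: phi j + c%:MP.
  by move=> i; apply: Fg.
pose A : 'M[K]_n := \matrix_(i, j) M i j.
have gA (i : 'I_n) : g i.+1 = \sum_j A i j *: phi j + (c i)%:MP.
  by rewrite gE; congr (_ + _); apply: eq_bigr => j _; rewrite mxE.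
have uA : A \in unitmx.
  exact: (indep_unitmx (q := fun i : 'I_n => g i.+1) gA g_indep).
apply: (affine_or_cotameMl (affine_aff c uA)).
apply: (@chain_cotame _ charK _ n_ge3 _ k g) => // [j jn|i].
  have := dg 1%N j.+1 (leq_trans jn nd).
  by rewrite mulm1n mderivmU1m /= subn1.
by rewrite gA ga_mulE affE // comp_lin.
Qed.

(** A row vector killing both [A - 1] and [b] is an invariant linear form. If only zero does,
    comparing coefficients shows that translation-invariant elements of the span are constant, so
    there is one block. *)
Lemma conj_translation_cotame phi a k : affine a ->
  (phi * trans (along k 1) = a * phi)%g -> affine_or_cotame phi.
Proof.
move=> aff_a phit; have [A [b [uA aE]]] := affine_mxP aff_a.
have phit' : (phi * trans (along k 1) = aff A b * phi)%g.
  by rewrite phit; congr (_ * _)%g; apply: ga_ext => i; rewrite aE affE.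
pose M := row_mx (A - 1%:M) (\col_i b i).
case: (boolP (kermx M == 0)) => [fM|]; last first.
  case/rowV0Pn => l /sub_kermxP; rewrite mul_mx_row => /eqP.
  rewrite row_mx_eq0 => /andP[/eqP lA /eqP lb] l0.
  exact: (fixed_form_cotame charK n_ge3 uA phit' l0 lA lb).
apply: (one_block_cotame (span1_mderiv aff_a phit)) => p [l [c ->]] dp.
have := omits_along 1 (mderiv0_omits charK dp).
rewrite comp_mpolyD comp_mpolyC raddf_sum /= => /addIr.
under eq_bigr => i _ do rewrite comp_mpolyZ -ga_mulE phit ga_mulE aE comp_lin.
under eq_bigr do rewrite scalerDr scaler_sumr.
rewrite big_split exchange_big /= => e.
pose lr : 'rV[K]_n := \row_i l i.
have le : \sum_j (lr *m (A - 1%:M)) ord0 j *: phi j = (- (lr *m \col_i b i)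
  ord0 ord0)%:MP.
  have -> : \sum_j (lr *m (A - 1%:M)) ord0 j *: phi j =
      \sum_j \sum_i l i *: (A i j *: phi j) - \sum_i l i *: phi i.
    rewrite -sumrB; apply: eq_bigr => j _; rewrite mulmxBr mulmx1 !mxE scalerBl.
    congr (_ - _); rewrite scaler_suml; apply: eq_bigr => i _.
    by rewrite mxE scalerA.
  rewrite -[X in _ - X]e opprD addrA subrr add0r mxE mpolyCN; congr (- _).
  rewrite raddf_sum; apply: eq_bigr => i _ /=.
  by rewrite !mxE mpolyCM mul_mpolyC.
have lA : lr *m (A - 1%:M) = 0.
  by apply/rowP => j; rewrite [RHS]mxE; apply: comps_free le j.
have lb : lr *m \col_i b i = 0.
  apply/matrixP => i j; rewrite !ord1 [RHS]mxE; apply/eqP.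
  rewrite -oppr_eq0 -(mpolyC_eq0 n) -le; apply/eqP; apply: big1 => m _.
  by rewrite lA mxE scale0r.
have lr0 : lr = 0.
  apply: (row_free_inj (A := M)); first by rewrite -kermx_eq0.
  by rewrite mul_mx_row lA lb row_mx0 mul0mx.
rewrite big1 ?add0r ?mcoeffC ?eqxx ?mulr1 // => i _.
by move/rowP/(_ i): lr0; rewrite !mxE => ->; rewrite scale0r.
Qed.

End AffineConj.

(** * Triangular automorphisms *)

Section Unipotent.
Context {K : fieldType} {n : nat}.
Implicit Types (p q Q R : {mpoly K[n]}) (f g s : GA K n) (u v w : 'I_n -> K).

Definition below (r : nat) : pred 'I_n := fun j => (j < r)%N.

(** Triangularity with the diagonal [u] made explicit, so that it can be followed through products
    and inverses. *)
Definition tri u g := forall i : 'I_n, vars (below i) (g i - u i *: 'X_i).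

Lemma triangular_tri g : triangular g -> exists2 u, forall i, u i != 0 & tri u
  g.
Proof.
case=> u [P [u0 vP gE]]; exists u => // i.
by rewrite gE addrC addKr; apply/in_first_varsE.
Qed.

Lemma tri_vars u g (i j : 'I_n) : tri u g -> (i < j)%N -> vars (below j) (g i).
Proof.
move=> tg ij; rewrite -[g i](subrK (u i *: 'X_i)); apply: varsD.
  by apply: sub_vars (tg i) => l /= li; apply: ltn_trans li ij.
by apply: varsZ; apply: varsX.
Qed.

Lemma triM u w f g : tri u f -> tri w g -> tri (fun i => u i * w i) (f * g)%g.
Proof.
move=> tf tg i; rewrite ga_mulE -[f i](subrK (u i *: 'X_i)) comp_mpolyD.
rewrite comp_mpolyZ comp_gaX -scalerA -addrA -scalerBr; apply: varsD.
  by apply: vars_comp (tf i) _ => j ji; apply: tri_vars tg ji.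
by apply: varsZ; apply: tg.
Qed.

(** Component [i] of the inverse is solved from that of [g], using only inverse components of
    smaller index. *)
Lemma triV u g : (forall i, u i != 0) -> tri u g -> tri (fun i => (u i)^-1)
  g^-1%g.
Proof.
move=> u0 tg i; have [r] := ubnP i; elim: r i => // r IHr i; rewrite ltnS => ir.
have gi : (g i - u i *: 'X_i) \mPo comps g^-1%g = 'X_i - u i *: g^-1%g i.
  by rewrite comp_mpolyB comp_mpolyZ comp_gaX -{1}[g i]comp_gaX comp_gaK.
have -> : g^-1%g i - (u i)^-1 *: 'X_i =
    - (u i)^-1 *: ((g i - u i *: 'X_i) \mPo comps g^-1%g).
  by rewrite gi scalerBr scalerA mulNr mulVf // scaleNr scaleN1r opprK addrC.
apply: varsZ; apply: vars_comp (tg i) _ => j ji.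
rewrite -/(component g^-1%g j) -[g^-1%g j](subrK ((u j)^-1 *: 'X_j)).
apply: varsD; last by apply: varsZ; apply: varsX.
apply: sub_vars (IHr j (leq_trans ji ir)) => l /= lj.
exact: ltn_trans lj ji.
Qed.

Lemma tri_trans v : tri (fun=> 1) (trans v).
Proof. by move=> i; rewrite transE scale1r addrC addKr; apply: varsC. Qed.

Lemma eq_tri u w g : u =1 w -> tri u g -> tri w g.
Proof. by move=> uw tg i; rewrite -uw. Qed.

Lemma tri_last u g (z : 'I_n) c : z = n.-1 :> nat -> tri u g ->
  (g * trans (along z c) = trans (along z (u z * c)) * g)%g.
Proof.
move=> zn tg; apply: ga_ext => i; rewrite trans_mulE ga_mulE.
rewrite -[g i](subrK (u i *: 'X_i)) comp_mpolyD omits_along; last first.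
  apply: sub_vars (tg i) => j /= ji; apply: contraTneq ji => ->.
  by rewrite -leqNgt zn -ltnS prednK ?ltn_ord // (leq_ltn_trans _ (ltn_ord i)).
rewrite comp_mpolyZ comp_gaX transE scalerDr addrA; congr (_ + _).
rewrite -mul_mpolyC -mpolyCM /along; case: eqP => [->|_] //.
by rewrite mulr0.
Qed.

(* [p] behaves like a polynomial of degree [d] under finite differences. *)
Let drops v d p := (msize p <= d.+1)%N /\ (msize (p \mPo comps (trans v) - p)
  <= d)%N.

Lemma msizeM_le1 p q d e : (msize p <= d)%N -> (msize q <= e.+1)%N ->
  (msize (p * q) <= d + e)%N.
Proof.
move=> pd qe; have [->|p0] := eqVneq p 0; first by rewrite mul0r msize0.
have [->|q0] := eqVneq q 0; first by rewrite mulr0 msize0.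
rewrite msizeM // -ltnS prednK; first by rewrite -addnS leq_add.
by rewrite addn_gt0 lt0n msize_poly_eq0 p0.
Qed.

Lemma dropsM v d e p q : drops v d p -> drops v e q -> drops v (d + e) (p * q).
Proof.
move=> [pd dp] [qe dq]; split; first by rewrite -addSn; apply: msizeM_le1.
have -> : (p * q) \mPo comps (trans v) - p * q =
    (p \mPo comps (trans v) - p) * (q \mPo comps (trans v)) +
    (q \mPo comps (trans v) - q) * p.
  by rewrite rmorphM /= mulrBl [_ * p]mulrBl addrA -[q * p]mulrC [X in _ - X +
    _]mulrC subrK.
apply: (leq_trans (msizeD_le _ _)); rewrite geq_max; apply/andP; split.
  apply: msizeM_le1 => //; rewrite -[q \mPo _](subrK q).
  apply: (leq_trans (msizeD_le _ _)); rewrite geq_max qe andbT.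
  exact: leqW.
by rewrite addnC; apply: msizeM_le1.
Qed.

(** [drops] holds for the variables and is multiplicative by the discrete Leibniz rule, so it holds
    for all monomials. *)
Lemma msize_trans_sub v p : p != 0 ->
  (msize (p \mPo comps (trans v) - p) < msize p)%N.
Proof.
move=> p0; have p1 : (0 < msize p)%N by rewrite lt0n msize_poly_eq0.
rewrite comp_mpolyEX [X in _ - X]mpolyE -sumrB -(prednK p1) ltnS.
apply: (leq_trans (msize_sum _ _ _)); apply/bigmax_leqP_seq => m mp _.
rewrite -scalerBr; apply: (leq_trans (msizeZ_le _ _)).
have [_ dX] : drops v (mdeg m) 'X_[m].
  have dropsX i : drops v 1 'X_i.
    rewrite /drops msizeX mdeg1 comp_gaX transE addrC addKr; split=> //.
    by rewrite msizeC; case: eqP.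
  have drops1 : drops v 0 1.
    by rewrite /drops msize1 comp_mpoly1 subrr msize0.
  rewrite mpolyXE_id mdegE.
  apply: (big_rec2 (fun d p => drops v d p)) => // i d q _; apply: dropsM.
  elim: (m i) => [|e IHe]; first by rewrite expr0.
  by rewrite exprS -add1n; apply: dropsM.
by apply: leq_trans dX _; rewrite -ltnS (prednK p1) msize_mdeg_lt.
Qed.

End Unipotent.

Section GroupIdentities.
Variable G : groupType.
Implicit Types x y z t v h : G.

(** Here [c] is the commutator of [s] and [v]: conjugating [t] by [h s h^-1] gives the conjugate of
    [c] by [h], times [t]. *)
Lemma conj_conj_mul h s c v t : (h * v = t * h)%g -> (c * v = s * v * s^-1)%g ->
  (h * s * h^-1 * t * (h * s * h^-1)^-1 = h * c * h^-1 * t)%g.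
Proof.
move=> hv cs; have -> : t = (h * v * h^-1)%g by rewrite hv mulgK.
rewrite !invgM invgK -!mulgA !(mulKg h); congr (_ * _)%g.
by rewrite [RHS]mulgA cs -!mulgA.
Qed.

Lemma conj_mul_chain h x y z t t' v : (z * t = t' * z)%g -> (y * t' = v * y)%g
  ->
  (h * x * y * z * t * (h * x * y * z)^-1 = h * (x * v * x^-1) * h^-1)%g.
Proof.
move=> zt yt; rewrite !invgM -!mulgA; congr (_ * (_ * _))%g.
by rewrite (mulgA z) zt -mulgA mulVKg (mulgA y) yt -mulgA mulVKg.
Qed.

End GroupIdentities.

(** * From 3-triangular automorphisms to conjugates of unipotent triangular ones *)

Section Main.
Context {K : fieldType} (charK : [pchar K]%R =i pred0).
Context {n : nat} (n_ge3 : (3 <= n)%N).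
Implicit Types (phi theta h s : GA K n) (k : 'I_n).

Lemma conj_affine_or_cotame theta k :
  affine_or_cotame (theta * trans (along k 1) * theta^-1)%g ->
  affine_or_cotame theta.
Proof.
case=> [aff_a|Ca].
  by apply: (conj_translation_cotame charK n_ge3 aff_a); rewrite mulgVK.
right; apply: cotame_gen Ca; apply: gen_mul; last exact/gen_inv/gen_aff_self.
apply: gen_mul; first exact: gen_aff_self.
exact/gen_aff_affine/affine_trans.
Qed.

(* If [s] fixes the first [r] variables, so does the commutator [c] of [s] and
   [trans v], and the nonlinear part of its next component has lower degree;
   up to translations, conjugation by [h] turns [c] into the conjugate of the
   translation along [x_k] by [h s h^-1]. *)
Lemma unipotent_conj_cotame h v k s :
  (h * trans v = trans (along k 1) * h)%g -> tri (fun=> 1) s ->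
  affine_or_cotame (h * s * h^-1)%g.
Proof.
(* Outer induction on a bound [d] for the number of variables not known to be fixed, inner induction
   on the size of the first nonlinear part [s z - 'X_z]. *)
move=> hv ts; suff H d r s0 : (n <= d + r)%N -> tri (fun=> 1) s0 ->
    (forall i : 'I_n, (i < r)%N -> s0 i = 'X_i) -> affine_or_cotame (h * s0 *
      h^-1)%g.
  by apply: (H n 0 s _ ts) => [|i]; rewrite ?addn0.
elim: d r s0 {s ts} => [|d IHd] r s nr ts s_id.
  have -> : s = 1%g.
    by apply: ga_ext => i; rewrite ga_oneE (s_id i (leq_trans (ltn_ord i) nr)).
  by rewrite mulg1 mulgV; left; apply: affine1.
have [rn|rn] := ltnP r n; last first.
  exact: (IHd r s (leq_trans rn (leq_addl _ _)) ts s_id).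
pose z := Ordinal rn; have [e] := ubnP (msize (s z - 'X_z)).
elim: e s ts s_id => [|e IHe] s ts s_id; first by rewrite ltn0.
rewrite ltnS => se.
have [Q0|Q0] := eqVneq (s z - 'X_z) 0.
  apply: (IHd r.+1 s _ ts) => [|i]; first by rewrite addnS.
  rewrite ltnS leq_eqVlt => /predU1P[ir|]; last exact: s_id.
  by have -> : i = z by [apply: val_inj]; apply/eqP; rewrite -subr_eq0 Q0.
set Q := s z - 'X_z in se Q0.
have trVv : (trans (fun i => - v i) * trans v)%g = 1%g.
  by rewrite transD; apply: ga_ext => i; rewrite transE ga_oneE addNr addr0.
have trvV : (trans v * trans (fun i => - v i))%g = 1%g.
  by rewrite transD; apply: ga_ext => i; rewrite transE ga_oneE addrN addr0.
have [c tc cs] : exists2 c, tri (fun=> 1) c & (c * trans v = s * trans v *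
  s^-1)%g.
  exists (s * trans v * s^-1 * trans (fun i => - v i))%g.
    have tV := triV (fun=> oner_neq0 K) ts.
    have := triM (triM (triM ts (@tri_trans _ _ v)) tV) (@tri_trans _ _ (fun i
      => - v i)).
    by apply: eq_tri => i; rewrite invr1 !mulr1.
  by rewrite -[LHS]mulgA trVv mulg1.
have cv : (c * trans v * s = s * trans v)%g by rewrite cs mulgVK.
(* Component [i] of [c * trans v * s = s * trans v] is compared; [c i - 'X_i] involves only
   variables fixed by [s], and [trans v] is then undone. *)
have cE (i : 'I_n) : (i <= r)%N -> c i - 'X_i =
    (s i - 'X_i) - ((s i - 'X_i) \mPo comps (trans (fun j => - v j))).
  move=> ir; set R := c i - 'X_i; set P := s i - 'X_i.
  have vR : vars (below i) R by have := tc i; rewrite scale1r.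
  have csE : (c * trans v * s)%g i = R \mPo comps (trans v) + (s i + (v i)%:MP).
    rewrite -mulgA ga_mulE -[c i](subrK 'X_i) -/R comp_mpolyD comp_gaX
      trans_mulE.
    congr (_ + _); apply: (eq_comp_vars (t' := comps (trans v)) vR) => j ji.
    rewrite -!/(component _ j) trans_mulE.
    by rewrite transE (s_id j (leq_trans ji ir)).
  have svE : (s * trans v)%g i = P \mPo comps (trans v) + ('X_i + (v i)%:MP).
    by rewrite ga_mulE -[s i](subrK 'X_i) comp_mpolyD comp_gaX transE.
  have RP : R \mPo comps (trans v) = P \mPo comps (trans v) - P.
    apply: (addIr (s i + (v i)%:MP)); rewrite -csE cv svE -addrA; congr (_ + _).
    by rewrite /P opprB addrA subrK.
  by rewrite -[R]comp_ga1 -trvV comp_gaM RP comp_mpolyB -comp_gaM trvV comp_ga1.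
have Pc : affine_or_cotame (h * c * h^-1)%g.
  apply: IHe => [//|i ir|].
    apply: subr0_eq; rewrite (cE i (ltnW ir)) (s_id i ir) subrr comp_mpoly0.
    exact: subr0.
  rewrite (cE z (leqnn r)) -/Q -msizeN opprB; apply: leq_trans se.
  exact: msize_trans_sub.
apply: (@conj_affine_or_cotame _ k).
rewrite (conj_conj_mul hv cs).
apply: (affine_or_cotameMr (affine_trans (fun i => - along k 1 i))).
rewrite -mulgA transD; have -> : trans (fun i => along k 1 i - along k 1 i) =
  1%g :> GA K n.
  by apply: ga_ext => i; rewrite transE ga_oneE subrr addr0.
by rewrite mulg1.
Qed.

(** A translation along the last variable stays a translation through [t3] and [a2]; conjugation by
    [t2] makes it unipotent triangular, and [h = t1 * a1] is the remaining conjugator. *)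
Lemma triangular_product_cotame (t1 a1 t2 a2 t3 : GA K n) :
  affine a1 -> affine a2 -> triangular t1 -> triangular t2 -> triangular t3 ->
  affine_or_cotame (t1 * a1 * t2 * a2 * t3)%g.
Proof.
move=> A1 A2 /triangular_tri[u1 u10 T1] /triangular_tri[u2 u20 T2].
move=> /triangular_tri[u3 u30 T3].
have n0 : (n.-1 < n)%N by case: (n) n_ge3.
pose z := Ordinal n0.
(* The factor [(u1 z)^-1] cancels the scaling by [t1], so that [h] carries [trans w] to the unit
   translation. *)
have [w a1w] := affine_trans_conj (along z (u1 z)^-1) (affineV A1).
have hw : (t1 * a1 * trans w = trans (along z 1) * (t1 * a1))%g.
  have {}a1w : (a1 * trans w = trans (along z (u1 z)^-1) * a1)%g.
    by apply: (can_inj (mulKg a1^-1%g)); rewrite mulKg [RHS]mulgA a1w mulgVK.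
  rewrite -[LHS]mulgA a1w mulgA (tri_last _ (erefl : z = n.-1 :> nat) T1).
  by rewrite (mulfV (u10 z)) mulgA.
have [v a2v] := affine_trans_conj (along z (u3 z * 1)) A2.
apply: (@conj_affine_or_cotame _ z).
rewrite (conj_mul_chain _ _ (tri_last 1 (erefl : z = n.-1 :> nat) T3) a2v).
apply: unipotent_conj_cotame hw _.
apply: eq_tri (triM (triM T2 (@tri_trans _ _ v)) (triV u20 T2)) => i.
by rewrite mulr1 mulfV.
Qed.

Lemma three_triangular_cotame phi : m_triangular 3 phi -> affine_or_cotame phi.
Proof.
case=> alpha [tau [aff_alpha tri_tau ->]]; rewrite !big_ord_recl big_ord0 mulg1.
move: (aff_alpha ord0) (aff_alpha (lift ord0 (lift ord0 (lift ord0 ord0)))).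
move: (triangular_product_cotame (aff_alpha (lift ord0 ord0))
  (aff_alpha (lift ord0 (lift ord0 ord0))) (tri_tau ord0)
  (tri_tau (lift ord0 ord0)) (tri_tau (lift ord0 (lift ord0 ord0)))).
move: (alpha ord0) (alpha (lift ord0 ord0)) (alpha (lift ord0 (lift ord0
  ord0))).
move: (alpha (lift ord0 (lift ord0 (lift ord0 ord0)))).
move: (tau ord0) (tau (lift ord0 ord0)) (tau (lift ord0 (lift ord0 ord0))).
move=> t1 t2 t3 a3 a0 a1 a2 P A0 A3.
apply: (affine_or_cotameMl (affineV A0)).
apply: (affine_or_cotameMr (affineV A3)).
by rewrite mulKg !mulgA mulgK.
Qed.

End Main.

Theorem theorem1 (K : fieldType) (charK : [pchar K]%R =i pred0)
    (n : nat) (n_ge3 : (3 <= n)%N) (phi : GA K n) :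
  m_triangular 3 phi -> affine phi \/ cotame phi.
Proof. exact: three_triangular_cotame. Qed.
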